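(* Let $\Gamma$ be a countable group and let $\bm{s}_\Gamma=\Gamma\curvearrowright^{s_\Gamma}([0,1]^\Gamma,\lambda^\Gamma)$ be the Bernoulli shift action of $\Gamma$, where $\lambda$ denotes Lebesgue measure on $[0,1]$. Let $\bm{a}=\Gamma\curvearrowright^a(X,\mu)$ be a free measure preserving action of $\Gamma$ on a non-atomic standard probability space $(X,\mu)$. Then $\bm{s}_\Gamma\times\bm{a}$ is weakly equivalent to $\bm{a}$.
   Context: A measure preserving action $\bm{a}=\Gamma\curvearrowright^a(X,\mu)$ of a countable group $\Gamma$ is a Borel action $a$ of $\Gamma$ on a standard Borel space $X$ preserving a Borel probability measure $\mu$ on $X$. It is free if $\mu$-almost every point has trivial stabilizer. Weak containment: for $\bm{a}$ on $(X,\mu)$ and $\bm{b}$ on $(Y,\nu)$, $\bm{a}\prec\bm{b}$ means that for every finite Borel partition $A_0,\dots,A_{k-1}$ of $X$, every finite $F\subseteq\Gamma$, and every $\epsilon>0$ there is a Borel partition $B_0,\dots,B_{k-1}$ of $Y$ with $|\mu(\gamma^aA_i\cap A_j)-\nu(\gamma^bB_i\cap B_j)|<\epsilon$ for all $\gamma\in F$ and $i,j<k$. Weak equivalence means $\bm{a}\prec\bm{b}$ and $\bm{b}\prec\bm{a}$. The shift action is $(\gamma\cdot f)(\delta)=f(\gamma^{-1}\delta)$; the product action is the diagonal action with the product measure. *)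

(* Defs.v *)
From HB Require Import structures.
From mathcomp Require Import all_boot all_order all_algebra.
From mathcomp Require Import finmap zify ring lra.
From mathcomp Require Import all_classical all_reals all_analysis.
From mathcomp Require Import measurable_realfun.
Set Implicit Arguments.
Unset Strict Implicit.
Unset Printing Implicit Defensive.
Import Order.TTheory GRing.Theory Num.Theory.
Import numFieldNormedType.Exports.
Local Open Scope classical_set_scope.
Local Open Scope ring_scope.

Section unit_interval.
Context (R : realType).

Definition unit_itv : Type := set_type (`[0, 1]%classic : set R).

HB.instance Definition _ := Choice.copy unit_itv (set_type (`[0, 1]%classic : set R)).

Lemma unit_itv0_subproof : (0 : R) \in (`[0, 1]%classic : set R).
Proof. by rewrite inE/= in_itv/= lexx ler01. Qed.

HB.instance Definition _ := isPointed.Build unit_itv (exist _ (0 : R) unit_itv0_subproof : unit_itv).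

(* [unit_itv] carries the Borel sigma-algebra, as the trace of that of R. *)
Definition unit_val (x : unit_itv) : R := val x.

HB.instance Definition _ := Measurable.copy unit_itv
  (g_sigma_algebra_preimageType (unit_val : unit_itv -> measurableTypeR R)).

Definition lebesgue_unit (A : set unit_itv) : \bar R :=
  lebesgue_measure (unit_val @` A).

Lemma unit_val_inj : injective unit_val.
Proof. exact: val_inj. Qed.

Lemma unit_val_itv (x : unit_itv) : (`[0, 1]%classic : set R) (unit_val x).
Proof. by have := valP x; rewrite inE. Qed.

Lemma image_unit_val_preimage (B : set R) :
  unit_val @` (unit_val @^-1` B) = `[0, 1]%classic `&` B.
Proof.
apply/seteqP; split => [_ [x Bx <-]|x [x01 Bx]]; first by split => //; exact: unit_val_itv.
by exists (exist _ x (mem_set x01)).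
Qed.

Lemma measurable_image_unit_val (A : set unit_itv) : measurable A ->
  measurable (unit_val @` A : set (measurableTypeR R)).
Proof.
move=> [B mB <-]; rewrite setTI image_unit_val_preimage.
by apply: measurableI => //; exact: measurable_itv.
Qed.

Lemma measurable_unit_val : measurable_fun setT (unit_val : unit_itv -> measurableTypeR R).
Proof. by move=> _ B mB; exists B. Qed.

Let lebesgue_unit0 : lebesgue_unit set0 = 0%E.
Proof. by rewrite /lebesgue_unit image_set0 measure0. Qed.

Let lebesgue_unit_ge0 A : (0 <= lebesgue_unit A)%E.
Proof. exact: measure_ge0. Qed.

Let lebesgue_unit_sigma_additive : semi_sigma_additive lebesgue_unit.
Proof.
move=> F mF tF mUF; rewrite /lebesgue_unit image_bigcup.
apply: (@measure_semi_sigma_additive _ _ _ (@lebesgue_measure R)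
  (fun n => unit_val @` F n : set (measurableTypeR R))).
- by move=> n; exact: measurable_image_unit_val.
- apply/trivIsetP => i j _ _ ij; move/trivIsetP : tF => /(_ i j Logic.I Logic.I ij).
  move=> Fij0; rewrite -subset0 => _ [[x Fix <-] [y Fjy /unit_val_inj yx]].
  have : (F i `&` F j) x by split => //; rewrite -yx.
  by rewrite Fij0.
- by rewrite -image_bigcup; exact: measurable_image_unit_val.
Qed.

HB.instance Definition _ := isMeasure.Build _ _ _ lebesgue_unit
  lebesgue_unit0 lebesgue_unit_ge0 lebesgue_unit_sigma_additive.

Let lebesgue_unit_setT : lebesgue_unit setT = 1%E.
Proof.
rewrite /lebesgue_unit -(preimage_setT unit_val) image_unit_val_preimage setIT.
by rewrite lebesgue_measure_itv/= lte_fin ltr01 oppr0 adde0.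
Qed.

HB.instance Definition _ :=
  Measure_isProbability.Build _ _ _ lebesgue_unit lebesgue_unit_setT.

End unit_interval.

(* An alias of the function type, which carries the product sigma-algebra (the
   one generated by the coordinate maps). *)
Definition power (I T : Type) : Type := I -> T.

Definition power_display : measure_display -> measure_display.
Proof. exact. Qed.

Section power_measurable.
Context (I : Type) d (T : measurableType d).

HB.instance Definition _ := Pointed.copy (power I T) (I -> T).

Definition coordinate (i : I) (f : power I T) : T := f i.

Definition power_measurable : set (set (power I T)) :=
  <<s \bigcup_i preimage_set_system setT (coordinate i) measurable >>.

Let power_measurable0 : power_measurable set0.
Proof. exact: sigma_algebra0. Qed.

Let power_measurableC A : power_measurable A -> power_measurable (~` A).
Proof. exact: sigma_algebraC. Qed.

Let power_measurable_bigcup (F : _^nat) :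
  (forall i, power_measurable (F i)) -> power_measurable (\bigcup_i (F i)).
Proof. exact: sigma_algebra_bigcup. Qed.

HB.instance Definition _ := @isMeasurable.Build (power_display d) (power I T)
  power_measurable power_measurable0 power_measurableC power_measurable_bigcup.

Lemma measurable_coordinate i : measurable_fun setT (coordinate i).
Proof. by move=> _ B mB; apply: sub_sigma_algebra; exists i => //; exists B. Qed.

Lemma measurable_power d' (U : measurableType d') (g : U -> power I T) :
  (forall i, measurable_fun setT (fun u => g u i)) -> measurable_fun setT g.
Proof.
move=> mg; apply: (measurability _ (erefl power_measurable)) => _ [_ [i _ [B mB <-]] <-].
by rewrite !setTI -comp_preimage -[X in measurable X]setTI; exact: mg.
Qed.

End power_measurable.

Definition cylinder (I : choiceType) (T : Type) (J : {fset I}) (B : I -> set T) : set (power I T) :=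
  [set f | forall i, i \in J -> B i (f i)].

(* The values on finite-dimensional cylinders characterize the product measure
   (power_probability_unique). *)
Definition is_power_probability (R : realType) (I : choiceType) d
    (T : measurableType d) (mu : probability T R)
    (P : probability (power I T) R) : Prop :=
  forall (J : {fset I}) (B : I -> set T), (forall i, measurable (B i)) ->
    P (cylinder J B) = (\prod_(i <- J) mu (B i))%E.

Section power_uniq.
Context (R : realType) (I : choiceType) d (T : measurableType d) (mu : probability T R).

Lemma cylinderE (J : {fset I}) (B : I -> set T) :
  cylinder J B = \bigcap_(i in [set` J]) (coordinate i @^-1` B i).
Proof. by apply/seteqP; split => f; exact. Qed.

Lemma measurable_cylinder (J : {fset I}) (B : I -> set T) :
  (forall i, measurable (B i)) -> measurable (cylinder J B).
Proof.
move=> mB; rewrite cylinderE bigcap_fset; apply: bigsetI_measurable => i _.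
by rewrite -[X in measurable X]setTI; exact: measurable_coordinate.
Qed.

Lemma power_probability_unique (P Q : probability (power I T) R) :
  is_power_probability mu P -> is_power_probability mu Q ->
  forall A, measurable A -> P A = Q A.
Proof.
move=> hP hQ.
pose G := [set A : set (power I T) |
  exists J B, (forall i, measurable (B i)) /\ A = cylinder J B].
have GT : G setT.
  exists fset0, (fun=> setT); split => //.
  by apply/seteqP; split => // f _ i; rewrite inE.
apply: (measure_unique G (fun=> setT)).
- apply/seteqP; split.
    apply: smallest_sub; first exact: smallest_sigma_algebra.
    move=> _ [i _ [B mB <-]]; apply: sub_sigma_algebra.
    exists [fset i]%fset, (fun=> B); split => //.
    rewrite setTI; apply/seteqP; split => f /=.
      by move=> Bf j; rewrite inE => /eqP ->.
    by move=> /(_ i); rewrite inE eqxx; exact.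
  apply: smallest_sub; first exact: sigma_algebra_measurable.
  by move=> _ [J [B [mB ->]]]; exact: measurable_cylinder.
- move=> _ _ [J [B [mB ->]]] [K [C [mC ->]]].
  exists (J `|` K)%fset, (fun i => (if i \in J then B i else setT) `&`
     (if i \in K then C i else setT)); split.
    by move=> i; apply: measurableI; case: ifP.
  apply/seteqP; split => f /=.
    by move=> [hB hC] i _; split; case: ifP => // /[dup]; [move/hB|move/hC].
  move=> h; split => i iJ; have := h i; rewrite inE iJ ?orbT => /(_ isT) [].
    by [].
  by [].
- by move=> _.
- by rewrite bigcup_const.
- move=> _ [J [B [mB ->]]]; exact: etrans (hP J B mB) (esym (hQ J B mB)).
- move=> _; apply: le_lt_trans (ltry 1).
  by have /eqP := probability_setT P; rewrite eq_le => /andP[].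
Qed.

End power_uniq.

(* Existence of the product of countably many copies of Lebesgue measure on
   [0, 1], which the library does not provide. Separating the binary digits of
   x in [0, 1[ of odd rank from those of even rank gives maps T1, T2 sending
   Lebesgue measure to its square (split_product), and T1, T1 \o T2,
   T1 \o T2 \o T2, ... are then independent and uniformly distributed.
   [dig m k] separates the last 2m binary digits of k. *)
Fixpoint dig (m k : nat) : nat * nat :=
  if m is m'.+1 then
    let d := dig m' (k %/ 4) in
    (2 * d.1 + (k %% 4) %/ 2, 2 * d.2 + k %% 2)%N
  else (0, 0)%N.

Fixpoint undig (m p q : nat) : nat :=
  if m is m'.+1 then (4 * undig m' (p %/ 2) (q %/ 2) + 2 * (p %% 2) + q %% 2)%N
  else 0%N.

Lemma dig_lt m k : ((dig m k).1 < 2 ^ m)%N /\ ((dig m k).2 < 2 ^ m)%N.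
Proof.
elim: m k => [|m IH] k //=; have [h1 h2] := IH (k %/ 4)%N.
by rewrite !expnS; split; lia.
Qed.

Lemma undig_lt m p q : (undig m p q < 4 ^ m)%N.
Proof.
elim: m p q => [|m IH] p q //=; have := IH (p %/ 2)%N (q %/ 2)%N.
by rewrite !expnS; lia.
Qed.

Lemma undigK m p q : (p < 2 ^ m)%N -> (q < 2 ^ m)%N -> dig m (undig m p q) = (p, q).
Proof.
elim: m p q => [|m IH] p q; first by rewrite expn0 !ltnS !leqn0 => /eqP -> /eqP ->.
rewrite !expnS => hp hq /=.
set u := undig _ _ _.
have -> : ((4 * u + 2 * (p %% 2) + q %% 2) %/ 4 = u)%N by lia.
by rewrite IH//=; [congr (_, _)| |]; lia.
Qed.

Lemma digK m k : (k < 4 ^ m)%N -> undig m (dig m k).1 (dig m k).2 = k.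
Proof.
elim: m k => [|m IH] k; first by rewrite expn0 ltnS leqn0 => /eqP ->.
rewrite expnS => hk /=.
set d := dig _ _.
have -> : ((2 * d.1 + (k %% 4) %/ 2) %/ 2 = d.1)%N by lia.
have -> : ((2 * d.2 + k %% 2) %/ 2 = d.2)%N by lia.
by rewrite IH; lia.
Qed.

Lemma count_dig m a b :
  (\sum_(k < 4 ^ m | (a <= (dig m k).1) && (b <= (dig m k).2)) 1 =
   (2 ^ m - a) * (2 ^ m - b))%N.
Proof.
have lt1 (p : 'I_(2 ^ m - a)) : (a + p < 2 ^ m)%N by have := ltn_ord p; lia.
have lt2 (p : 'I_(2 ^ m - b)) : (b + p < 2 ^ m)%N by have := ltn_ord p; lia.
pose h (pq : 'I_(2 ^ m - a) * 'I_(2 ^ m - b)) : 'I_(4 ^ m) :=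
  Ordinal (undig_lt m (a + pq.1) (b + pq.2)).
rewrite -[RHS](_ : #|{: 'I_(2 ^ m - a) * 'I_(2 ^ m - b)}| = _); last first.
  by rewrite card_prod !card_ord.
have hK pq : dig m (h pq) = (a + pq.1, b + pq.2)%N by apply: undigK.
have hinj : injective h.
  move=> pq pq' e; have := hK pq; rewrite e hK => -[e1 e2].
  case: pq e1 e2 {e} => [p q]; case: pq' => [p' q'] /= e1 e2.
  by congr (_, _); apply: val_inj => /=; lia.
rewrite -(card_codom hinj) sum1_card.
apply: eq_card => k; apply/idP/codomP => [|[pq ->]].
  rewrite unfold_in/= => /andP[h1 h2]; have [l1 l2] := dig_lt m k.
  have h1' : ((dig m k).1 - a < 2 ^ m - a)%N by lia.
  have h2' : ((dig m k).2 - b < 2 ^ m - b)%N by lia.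
  exists (Ordinal h1', Ordinal h2').
  by apply: val_inj => /=; rewrite !subnKC// digK.
by rewrite unfold_in/= hK/= !leq_addr.
Qed.

Section unit_probability.
Context (R : realType).
Local Notation mR := (measurableTypeR R).
Local Notation mu := (@lebesgue_measure R).
Local Open Scope ereal_scope.

(* Lebesgue measure on [0, 1[, seen as a probability on R. *)
Definition P01 : set mR -> \bar R :=
  @mrestr _ mR R `[0%R, 1%R[%classic mu (measurable_itv _).

HB.instance Definition _ := Measure.on P01.

Let P01_setT : P01 setT = 1.
Proof.
by rewrite /P01 /mrestr setTI lebesgue_measure_itv/= lte_fin ltr01 oppr0 adde0.
Qed.

HB.instance Definition _ := Measure_isProbability.Build _ _ _ P01 P01_setT.

Lemma P01_ray s : P01 `]s, +oo[%classic =
  (if (s < 0)%R then 1 else if (s < 1)%R then (1 - s)%R%:E else 0).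
Proof.
rewrite /P01 /mrestr.
have [s0|s0] := ltP s 0%R.
  rewrite setIidr; last first.
    move=> x /=; rewrite !in_itv/= andbT => /andP[x0 _]; exact: lt_le_trans s0 x0.
  by rewrite lebesgue_measure_itv/= lte_fin ltr01 oppr0 adde0.
have [s1|s1] := ltP s 1%R.
  rewrite (_ : _ `&` _ = `]s, 1%R[%classic).
    by rewrite lebesgue_measure_itv/= lte_fin s1 EFinB.
  apply/seteqP; split => x /=; rewrite !in_itv/= ?andbT.
    by move=> [-> /andP[_ ->]].
  by move=> /andP[sx ->]; rewrite sx (le_trans s0 (ltW sx)).
rewrite (_ : _ `&` _ = set0) ?measure0//.
rewrite -subset0 => x /=; rewrite !in_itv/= andbT => -[sx /andP[_ x1]].
by have := lt_trans (le_lt_trans s1 sx) x1; rewrite ltxx.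
Qed.

Lemma rays_unique (m1 m2 : {measure set mR -> \bar R}) : m1 setT < +oo ->
  (forall s, m1 `]s, +oo[%classic = m2 `]s, +oo[%classic) ->
  forall A, measurable A -> m1 A = m2 A.
Proof.
move=> m1oo m12; apply: (@measure_unique _ R mR (@RGenOInfty.G R) (fun k : nat => `](- k%:R)%R, +oo[%classic)).
- exact: RGenOInfty.measurableE.
- move=> _ _ [x ->] [y ->]; exists (Num.max x y).
  by apply/seteqP; split => z /=; rewrite !in_itv/= !andbT gt_max => /andP.
- by move=> k; eexists.
- apply/seteqP; split => // x _; exists (Num.truncn (`|x|)%R).+1 => //=.
  rewrite in_itv/= andbT ltrNl (le_lt_trans (ler_norm _))// normrN.
  by have /andP[] := truncn_itv (normr_ge0 x).
- by move=> _ [s ->].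
- move=> k; apply: le_lt_trans m1oo; apply: le_measure; rewrite ?inE//.
Qed.

Definition cell m k : set mR :=
  `[(k%:R / (4 ^ m)%:R)%R, (k.+1%:R / (4 ^ m)%:R)%R[%classic.

Lemma P01_trunc m (p : pred nat) :
  P01 [set x : R | p (Num.truncn ((4 ^ m)%:R * x))%R] =
  ((\sum_(k < 4 ^ m | p k) 1)%N%:R / (4 ^ m)%:R)%R%:E.
Proof.
have K0 : (0 < (4 ^ m)%:R :> R)%R by rewrite ltr0n expn_gt0.
rewrite /P01 /mrestr.
rewrite (_ : _ `&` _ = \big[setU/set0]_(k < 4 ^ m | p k) cell m k).
  rewrite measure_bigsetU_ord_cond.
  - rewrite (eq_bigr (fun=> ((4 ^ m)%:R^-1)%R%:E)); last first.
      move=> k _; transitivity (lebesgue_measure (cell m k)) => //.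
      rewrite /cell lebesgue_measure_itv/= lte_fin.
      rewrite ltr_pM2r ?invr_gt0// ltr_nat ltnSn -EFinB -mulrBl -natrB//.
      by rewrite subSnn mul1r.
    rewrite sumEFin natr_sum mulr_suml; congr EFin.
    by apply: eq_bigr => k _; rewrite mul1r.
  - by move=> k _; exact: measurable_itv.
  - move=> /= i j _ _ [x []]; rewrite /cell /= !in_itv/=.
    rewrite !ler_pdivrMr// !ltr_pdivlMr// => /andP[i1 i2] /andP[j1 j2].
    apply: val_inj => /=; rewrite -(truncn_def (x := (x * (4 ^ m)%:R)%R) (n := i)) ?i1//.
    by rewrite -(truncn_def (x := (x * (4 ^ m)%:R)%R) (n := j)) ?j1.
rewrite big_mkcond/= -(bigcup_mkord _ (fun k => if p k then cell m k else set0)).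
apply/seteqP; split => x /=.
  rewrite in_itv/= => -[px /andP[x0 x1]].
  have y0 : (0 <= (4 ^ m)%:R * x)%R by rewrite mulr_ge0// ltW.
  have /andP[h1 h2] := truncn_itv y0.
  exists (Num.truncn ((4 ^ m)%:R * x)%R).
    by rewrite /= truncn_lt_nat// gtr_pMr.
  by rewrite px /cell /= in_itv/= ler_pdivrMr// ltr_pdivlMr// (mulrC x) h1 h2.
move=> [k /= km]; case: ifPn => // pk; rewrite /cell /= !in_itv/= ler_pdivrMr// ltr_pdivlMr// => /andP[h1 h2].
rewrite (mulrC _ x) (truncn_def (n := k)) ?h1//; split => //.
have x0 : (0 <= x)%R by rewrite -(pmulr_lge0 _ K0) (le_trans _ h1).
rewrite x0/= -(ltr_pM2r K0) mul1r (lt_le_trans h2)// ler_nat.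
exact: km.
Qed.

End unit_probability.

Section split_digits.
Context (R : realType).
Local Notation mR := (measurableTypeR R).

Definition digit_of (b : bool) (d : nat * nat) : nat := if b then d.1 else d.2.

Definition Tm (b : bool) (m : nat) (x : R) : R :=
  (digit_of b (dig m (Num.truncn ((4 ^ m)%:R * x))))%:R / (2 ^ m)%:R.

Lemma measurable_nat_trunc (h : nat -> R) (c : R) :
  measurable_fun setT (fun x : R => h (Num.truncn (c * x))).
Proof.
have mc : measurable_fun setT (fun x : R => c * x).
  exact: measurable_funM.
move=> _ B mB.
rewrite (_ : _ `&` _ = \bigcup_(n in [set n | B (h n)])
    [set x | Num.truncn (c * x) = n]); last first.
  apply/seteqP; split => x /=; first by move=> [_ Bh]; exists (Num.truncn (c * x)).
  by move=> [n /= Bn e]; split => //; rewrite e.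
apply: bigcup_measurable => n _.
have [-> | n0] := eqVneq n 0%N.
  rewrite (_ : [set x | _] = setT `&` (fun x : R => c * x) @^-1` `]-oo, 1%R[%classic).
    by apply: mc => //; exact: measurable_itv.
  rewrite setTI; apply/seteqP; split => x /=; rewrite in_itv/=.
    by move=> /truncn0Pn; rewrite -ltNge.
  by rewrite ltNge => /truncn0Pn.
rewrite (_ : [set x | _] = setT `&` (fun x : R => c * x) @^-1` `[n%:R, n.+1%:R[%classic).
  by apply: mc => //; exact: measurable_itv.
rewrite setTI; apply/seteqP; split => x /=; rewrite in_itv/=.
  move=> e; have c0 : 0 <= c * x.
    rewrite leNgt; apply/negP => /ltW c0; move: n0; rewrite -e.
    by case/negP; apply/eqP/truncn0Pn; rewrite -ltNge (le_lt_trans c0).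
  by rewrite -e truncn_itv.
exact: truncn_def.
Qed.

Lemma measurable_Tm b m : measurable_fun setT (Tm b m).
Proof.
exact: (measurable_nat_trunc (fun k => (digit_of b (dig m k))%:R / (2 ^ m)%:R)).
Qed.

Lemma pow2_gt0 m : 0 < (2 ^ m)%:R :> R.
Proof. by rewrite ltr0n expn_gt0. Qed.

Lemma Tm_le1 b m x : Tm b m x <= 1.
Proof.
rewrite /Tm ler_pdivrMr ?pow2_gt0// mul1r ler_nat.
by case: b; have [h1 h2] := dig_lt m (Num.truncn ((4 ^ m)%:R * x)); exact: ltnW.
Qed.

Lemma trunc4 (y : R) : (Num.truncn (4%:R * y) %/ 4)%N = Num.truncn y.
Proof.
have [y0|y0] := ltP y 0.
  by rewrite !(eqP (introT eqP (truncn0Pn _ _)))// -?ltNge; lra.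
have y40 : 0 <= 4%:R * y by lra.
have /andP[h1 h2] := truncn_itv y40.
apply/esym/truncn_def.
set k := Num.truncn _ in h1 h2 *.
have e := divn_eq k 4; have l := ltn_pmod k (isT : 0 < 4)%N.
apply/andP; split.
  rewrite -(ler_pM2l (_ : 0 < 4%:R)) ?ltr0n// (le_trans _ h1)//.
  by rewrite -natrM ler_nat; lia.
rewrite -(ltr_pM2l (_ : 0 < 4%:R)) ?ltr0n// (lt_le_trans h2)//.
by rewrite -natrM ler_nat; lia.
Qed.

Lemma Tm_nd b x : nondecreasing_seq (Tm b ^~ x).
Proof.
apply/nondecreasing_seqP => m; rewrite /Tm.
rewrite ler_pdivlMr ?pow2_gt0// mulrAC ler_pdivrMr ?pow2_gt0// -!natrM ler_nat.
rewrite [in leqRHS]expnS natrM -mulrA.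
have := trunc4 ((4 ^ m)%:R * x).
set k := Num.truncn (4%:R * _); set k' := Num.truncn _ => kk'.
rewrite /dig -/dig kk' expnS; by case: b => /=; rewrite mulnA leq_mul2r mulnC leq_addr orbT.
Qed.

Definition split_coord b x := limn (Tm b ^~ x).

Lemma is_cvg_Tm b x : cvgn (Tm b ^~ x).
Proof.
apply: nondecreasing_is_cvgn; first exact: Tm_nd.
by exists 1 => _ [m _ <-]; exact: Tm_le1.
Qed.

Lemma measurable_split_coord b : measurable_fun setT (split_coord b).
Proof.
apply: (@measurable_fun_cvg _ _ _ _ (Tm b)) => [m|x _].
  exact: measurable_Tm.
exact: is_cvg_Tm.
Qed.

Lemma split_coord_gt b s x : s < split_coord b x <-> exists m, s < Tm b m x.
Proof.
split=> [sx|[m sm]].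
  apply: contrapT => /forallNP h; have : split_coord b x <= s.
    apply: limr_le; first exact: is_cvg_Tm.
    by apply: nearW => m; rewrite leNgt; apply/negP.
  by rewrite leNgt sx.
apply: lt_le_trans sm _.
by apply: (@nondecreasing_cvgn_le _ (Tm b ^~ x)); [exact: Tm_nd|exact: is_cvg_Tm].
Qed.

Definition thr m (s : R) : nat := if s < 0 then 0%N else (Num.truncn ((2 ^ m)%:R * s)).+1.

Lemma Tm_gt b m s x :
  (s < Tm b m x) = (thr m s <= digit_of b (dig m (Num.truncn ((4 ^ m)%:R * x))))%N.
Proof.
rewrite /thr /Tm; set p := digit_of _ _.
have [s0|s0] := ltP s 0; first by rewrite (lt_le_trans s0)// divr_ge0.
rewrite ltr_pdivlMr ?pow2_gt0// truncn_lt_nat; last by rewrite mulr_ge0// ltW// pow2_gt0.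
by rewrite mulrC.
Qed.

Lemma P01_Tm m s t :
  @P01 R ([set x | s < Tm true m x] `&` [set x | t < Tm false m x]) =
  (((2 ^ m - thr m s)%:R / (2 ^ m)%:R) * ((2 ^ m - thr m t)%:R / (2 ^ m)%:R))%:E.
Proof.
pose p k := ((thr m s <= (dig m k).1) && (thr m t <= (dig m k).2))%N.
rewrite (_ : _ `&` _ = [set x : R | p (Num.truncn ((4 ^ m)%:R * x))%R]).
  rewrite P01_trunc count_dig; congr EFin.
  by rewrite mulf_div -!natrM -expnMn.
by apply/seteqP; split => x /=; rewrite !Tm_gt /p => /andP.
Qed.

Lemma P01_ray_lim s :
  ((2 ^ m - thr m s)%:R / (2 ^ m)%:R : R) @[m --> \oo] --> fine (@P01 R `]s, +oo[%classic).
Proof.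
rewrite P01_ray /thr.
have [s0|s0] := ltP s 0.
  rewrite (_ : (fun m => _) = cst 1); first exact: cvg_cst.
  by apply/funext => m; rewrite subn0 divff// gt_eqF// pow2_gt0.
have [s1|s1] := ltP s 1; last first.
  rewrite (_ : (fun m => _) = cst 0); first exact: cvg_cst.
  apply/funext => m; rewrite (_ : (_ - _)%N = 0%N) ?mul0r//.
  apply/eqP; rewrite subn_eq0 leqW// truncn_ge_nat ?ler_peMr// ?mulr_ge0//.
apply: (@squeeze_cvgr _ _ _ _ (fun m => 1 - s - (2^-1) ^+ m) (cst (1 - s))).
- apply: nearW => m /=.
  have y0 : 0 <= (2 ^ m)%:R * s by rewrite mulr_ge0.
  have /andP[h1 h2] := truncn_itv y0.
  have lt : (Num.truncn ((2 ^ m)%:R * s) < 2 ^ m)%N.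
    by rewrite truncn_lt_nat// gtr_pMr// pow2_gt0.
  rewrite ler_pdivlMr ?pow2_gt0// ler_pdivrMr ?pow2_gt0// natrB//.
  have e : 2^-1 ^+ m * (2 ^ m)%:R = 1 :> R.
    by rewrite natrX -exprMn mulVf ?expr1n// pnatr_eq0.
  rewrite -natr1 in h2 *; rewrite !mulrBl e mul1r.
  rewrite (mulrC s).
  by apply/andP; split; lra.
- rewrite -[X in _ --> X]subr0; apply: cvgB; first exact: cvg_cst.
  by apply: cvg_expr; rewrite ger0_norm ?invr_ge0// invf_lt1 ?ltr1n.
- exact: cvg_cst.
Qed.

End split_digits.

Section iid_uniform.
Context (R : realType).
Local Notation mR := (measurableTypeR R).
Local Notation P := (@P01 R).
Local Notation T1 := (@split_coord R true).
Local Notation T2 := (@split_coord R false).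

Lemma measurable_pre (f : R -> R) (B : set mR) :
  measurable_fun setT f -> measurable B -> measurable (f @^-1` B : set mR).
Proof. by move=> mf mB; rewrite -[X in measurable X]setTI; exact: mf. Qed.

Lemma split_rays s t :
  P (T1 @^-1` `]s, +oo[%classic `&` T2 @^-1` `]t, +oo[%classic) =
  (P `]s, +oo[%classic * P `]t, +oo[%classic)%E.
Proof.
pose F m : set mR := [set x | s < Tm true m x] `&` [set x | t < Tm false m x].
have ndF : nondecreasing_seq F.
  move=> m n mn; apply/subsetPset => x [/= h1 h2]; split => /=.
    by apply: lt_le_trans h1 _; exact: Tm_nd.
  by apply: lt_le_trans h2 _; exact: Tm_nd.
have TmE b m r : [set x | r < Tm b m x] = Tm b m @^-1` `]r, +oo[%classic.
  by apply/seteqP; split => x /=; rewrite in_itv/= andbT.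
have mF m : measurable (F m).
  by rewrite /F !TmE; apply: measurableI; apply: measurable_pre;
    (exact: measurable_Tm || exact: measurable_itv).
have E : T1 @^-1` `]s, +oo[%classic `&` T2 @^-1` `]t, +oo[%classic = \bigcup_m F m.
  apply/seteqP; split => x /=; rewrite !in_itv/= !andbT.
    move=> [/split_coord_gt[m hm] /split_coord_gt[n hn]].
    exists (maxn m n) => //; split => /=.
      by apply: lt_le_trans hm _; apply: Tm_nd; exact: leq_maxl.
    by apply: lt_le_trans hn _; apply: Tm_nd; exact: leq_maxr.
  by move=> [m _ [h1 h2]]; split; apply/split_coord_gt; exists m.
rewrite E.
have mU : measurable (\bigcup_m F m) by exact: bigcup_measurable.
have h1 := @nondecreasing_cvg_mu _ _ _ P F mF mU ndF.
have h2 : (P \o F) m @[m --> \oo] -->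
    (fine (P `]s, +oo[%classic) * fine (P `]t, +oo[%classic))%:E.
  rewrite (_ : P \o F = EFin \o (fun m => ((2 ^ m - thr m s)%:R / (2 ^ m)%:R) *
      ((2 ^ m - thr m t)%:R / (2 ^ m)%:R))); last first.
    by apply/funext => m /=; rewrite P01_Tm.
  by apply: cvg_EFin; [exact: nearW|apply: cvgM; exact: P01_ray_lim].
transitivity (fine (P `]s, +oo[%classic) * fine (P `]t, +oo[%classic))%:E.
  exact: cvg_unique h1 h2.
by rewrite EFinM !fineK//; apply: fin_num_measure; exact: measurable_itv.
Qed.

Lemma rays_scale d (U : measurableType d) (m : {measure set U -> \bar R}) (f : U -> mR) (r : {nonneg R}) :
  (m setT < +oo)%E -> measurable_fun setT f ->
  (forall s, m (f @^-1` `]s, +oo[%classic) = r%:num%:E * P `]s, +oo[%classic)%E ->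
  forall A, measurable A -> (m (f @^-1` A) = r%:num%:E * P A)%E.
Proof.
move=> moo mf h A mA.
apply: (@rays_unique R (pushforward m f) (mscale r P) _ _ A mA).
- exact: moo.
- exact: h.
Qed.

Lemma split_product (A B : set mR) : measurable A -> measurable B ->
  P (T1 @^-1` A `&` T2 @^-1` B) = (P A * P B)%E.
Proof.
move=> mA mB.
have fP (C : set mR) : measurable C -> P C \is a fin_num by move=> mC; exact: fin_num_measure.
have step1 t : P (T1 @^-1` A `&` T2 @^-1` `]t, +oo[%classic) = (P A * P `]t, +oo[%classic)%E.
  have mD : measurable (T2 @^-1` `]t, +oo[%classic : set mR).
    by apply: measurable_pre; [exact: measurable_split_coord|exact: measurable_itv].
  pose r := NngNum (fine_ge0 (measure_ge0 P `]t, +oo[%classic)).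
  have rE : r%:num%:E = P `]t, +oo[%classic.
    by rewrite /= fineK//; apply: fP; exact: measurable_itv.
  rewrite muleC -rE.
  apply: (@rays_scale _ _ (mrestr P mD) T1 r) => //.
  - by apply: fin_num_fun_lty; exact: fin_num_measure.
  - exact: measurable_split_coord.
  - by move=> s; rewrite rE muleC -split_rays.
have mD : measurable (T1 @^-1` A : set mR).
  by apply: measurable_pre => //; exact: measurable_split_coord.
pose r := NngNum (fine_ge0 (measure_ge0 P A)).
have rE : r%:num%:E = P A by rewrite /= fineK//; exact: fP.
rewrite setIC -rE.
apply: (@rays_scale _ _ (mrestr P mD) T2 r) => //.
- by apply: fin_num_fun_lty; exact: fin_num_measure.
- exact: measurable_split_coord.
- by move=> s; rewrite rE -step1 setIC.
Qed.

Fixpoint iid_seq n : R -> R := if n is n'.+1 then iid_seq n' \o T2 else T1.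

Lemma measurable_iid_seq n : measurable_fun setT (iid_seq n).
Proof.
elim: n => [|n IH] /=; first exact: measurable_split_coord.
by apply: measurableT_comp => //; exact: measurable_split_coord.
Qed.

Lemma iid_seqP n (B : nat -> set mR) : (forall k, measurable (B k)) ->
  P (\bigcap_(k < n) iid_seq k @^-1` B k) = (\prod_(k < n) P (B k))%E.
Proof.
elim: n B => [|n IH] B mB.
  rewrite big_ord0 (_ : bigcap _ _ = setT) ?probability_setT//.
  by apply/seteqP; split.
rewrite big_ord_recl /= -(IH (B \o S))//.
rewrite -split_product//.
  congr (P _); apply/seteqP; split => x /=.
    by move=> h; split; [exact: (h 0%N)|move=> k /= kn; exact: (h k.+1)].
  by move=> [h0 h] [|k] /= kn; [exact: h0|exact: h].
rewrite bigcap_mkord; apply: bigsetI_measurable => k _; apply: measurable_pre => //.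
- exact: measurable_iid_seq.
- exact: mB.
- by move=> k; exact: mB.
Qed.

Definition clamp (x : R) : unit_itv R.
Proof.
refine (exist _ (Num.max 0 (Num.min x 1)) _).
by rewrite inE/= in_itv/= le_max lexx/= ge_max ler01/= ge_min lexx orbT.
Defined.

Lemma measurable_clamp : measurable_fun setT (clamp : mR -> unit_itv R).
Proof.
move=> _ _ [B mB <-]; rewrite !setTI.
rewrite (_ : _ @^-1` _ = (fun x : R => Num.max 0 (Num.min x 1)) @^-1` B)//.
apply: measurable_pre => //.
have m1 : measurable_fun setT (fun x : R => Num.min x 1).
  by apply: (@measurable_minr _ _ R setT (fun x : R => x) (cst 1)); [exact: measurable_id|exact: measurable_cst].
by apply: (@measurable_maxr _ _ R setT (cst 0)) m1; exact: measurable_cst.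
Qed.

Lemma P01_clamp (A : set (unit_itv R)) : measurable A ->
  P (clamp @^-1` A) = lebesgue_unit A.
Proof.
move=> [B mB <-]; rewrite setTI.
rewrite /lebesgue_unit image_unit_val_preimage /P01 /mrestr.
have -> : clamp @^-1` (@unit_val R @^-1` B) `&` `[0, 1[%classic = B `&` `[0, 1[%classic.
  apply/seteqP; split => x /=; rewrite in_itv/= => -[+ /[dup] x01 /andP[x0 x1]];
  by rewrite /clamp/unit_val/= (min_idPl (ltW x1)) (max_idPr x0).
rewrite setIC.
have -> : `[0, 1]%classic `&` B = (`[0, 1[%classic `&` B) `|` ([set 1] `&` B).
  rewrite -setIUl; congr (_ `&` _); apply/seteqP; split => x /=; rewrite !in_itv/=.
    by move=> /andP[x0]; rewrite le_eqVlt => /predU1P[->|x1]; [right|left; rewrite x0].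
  by case=> [/andP[-> /ltW]|->]; rewrite ?lexx ?ler01.
have m1 : measurable ([set 1] `&` B : set mR).
  by apply: measurableI => //; exact: measurable_set1.
rewrite measureU//.
- rewrite [X in (_ + X)%E](_ : _ = 0%E) ?adde0//.
  apply: (@subset_measure0 _ _ _ lebesgue_measure _ [set 1]) => //.
  + exact: lebesgue_measure_set1.
- by apply: measurableI => //; exact: measurable_itv.
- rewrite -subset0 => x [[/= x01 _] [/= x1 _]].
  by move: x01; rewrite x1 in_itv/= => /andP[_]; rewrite ltxx.
Qed.

Lemma power_lebesgue_exists (I : choiceType) : countable [set: I] ->
  exists Q : probability (power I (unit_itv R)) R,
    is_power_probability (@lebesgue_unit R) Q.
Proof.
move=> /countable_injP[e inj_e].
have {}inj_e : injective e by move=> i j; apply: inj_e; rewrite inE.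
pose phi (x : mR) : power I (unit_itv R) := fun i => clamp (iid_seq (e i) x).
have mphi : measurable_fun setT phi.
  apply: measurable_power => i.
  exact: (measurableT_comp measurable_clamp (measurable_iid_seq (e i))).
exists (distribution (P : probability mR R) (mfun_Sub (mem_set mphi))).
move=> J B mB.
pose C k : set mR := if [pick i : J | e (val i) == k] is Some i then clamp @^-1` B (val i) else setT.
have Ce i : i \in J -> C (e i) = clamp @^-1` B i.
  move=> iJ; rewrite /C; case: pickP => [j /eqP/inj_e ->//|/(_ [` iJ]%fset)].
  by rewrite /= eqxx.
have mC k : measurable (C k).
  rewrite /C; case: pickP => // j _; rewrite -[X in measurable X]setTI.
  exact: measurable_clamp.
pose n := \max_(i <- J) (e i).+1.
have en i : i \in J -> (e i < n)%N.
  by move=> iJ; rewrite /n; exact: (@leq_bigmax_seq _ _ xpredT (fun i => (e i).+1)).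
rewrite /distribution /pushforward.
transitivity (P (\bigcap_(k < n) iid_seq k @^-1` C k)).
  congr (P _); apply/seteqP; split => x /=.
    move=> h k /= kn; rewrite /C; case: pickP => //= j /eqP <-.
    exact: h (fsvalP j).
  by move=> h i iJ; have := h _ (en _ iJ); rewrite /= Ce.
rewrite iid_seqP//.
rewrite -(big_mkord xpredT (fun k => P (C k))) /=.
transitivity (\prod_(k <- [seq e i | i <- J]) P (C k))%E.
  rewrite (bigID (mem [seq e i | i <- J]))/= [X in (_ * X)%E]big1 ?mule1.
    rewrite -big_filter; apply: perm_big; apply: uniq_perm.
    - by rewrite filter_uniq// iota_uniq.
    - by rewrite map_inj_uniq// fset_uniq.
    - move=> k; rewrite mem_filter mem_index_iota/=.
      apply/andP/idP => [[]//|kJ]; split => //.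
      by move: kJ => /mapP[i iJ ->]; exact: en.
  move=> k kJ; rewrite /C; case: pickP => [j /eqP jk|_]; last exact: probability_setT.
  by case/negP: kJ; rewrite -jk; apply: map_f; exact: fsvalP.
by rewrite big_map; apply: eq_big_seq => i iJ; rewrite Ce// P01_clamp.
Qed.

End iid_uniform.

Definition lebesgue_power (R : realType) (I : choiceType)
    (cI : countable [set: I]) : probability (power I (unit_itv R)) R :=
  sval (cid (power_lebesgue_exists R cI)).

Lemma lebesgue_powerP (R : realType) (I : choiceType) (cI : countable [set: I]) :
  is_power_probability (@lebesgue_unit R) (lebesgue_power R cI).
Proof. exact: svalP (cid (power_lebesgue_exists R cI)). Qed.

Record pmp_action (R : realType) (G : groupType) d (X : measurableType d)
    (mu : probability X R) := PmpAction {
  act :> G -> X -> X;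
  act1 : forall x, act 1%g x = x;
  actM : forall g h x, act (g * h)%g x = act g (act h x);
  measurable_act : forall g, measurable_fun setT (act g);
  act_preserving : forall g A, measurable A -> mu (act g @^-1` A) = mu A }.

Section bernoulli_shift.
Context (R : realType) (G : groupType) (cG : countable [set: G]).

Definition shift_map (T : Type) (g : G) (f : power G T) : power G T :=
  fun d => f (g^-1 * d)%g.

Let U := unit_itv R.

Let shift1 (f : power G U) : shift_map 1%g f = f.
Proof. by apply/funext => d; rewrite /shift_map invg1 mul1g. Qed.

Let shiftM g h (f : power G U) : shift_map (g * h)%g f = shift_map g (shift_map h f).
Proof. by apply/funext => d; rewrite /shift_map invgM mulgA. Qed.

Let measurable_shift g : measurable_fun setT (@shift_map U g).
Proof. by apply: measurable_power => i; exact: measurable_coordinate. Qed.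

Let shift_preserving g (A : set (power G U)) : measurable A ->
  lebesgue_power R cG (@shift_map U g @^-1` A) = lebesgue_power R cG A.
Proof.
move=> mA; pose Q := lebesgue_power R cG.
apply: (@power_probability_unique _ _ _ _ (@lebesgue_unit R)
  (distribution Q (mfun_Sub (mem_set (measurable_shift g)))) Q) => //; last exact: lebesgue_powerP.
move=> J B mB; rewrite /distribution /pushforward.
transitivity (Q (@shift_map U g @^-1` cylinder J B)) => //.
rewrite (_ : _ @^-1` _ = cylinder [fset (g^-1 * i)%g | i in J]%fset (fun i => B (g * i)%g)).
  rewrite lebesgue_powerP; last by move=> i; exact: mB.
  rewrite big_imfset/=; last by move=> i j _ _; exact: mulgI.
  by apply: eq_bigr => i _; rewrite mulVKg.
apply/seteqP; split => f /= h i.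
  by move=> /imfsetP[j /= jJ ->]; rewrite mulVKg; exact: h.
move=> iJ; have := h (g^-1 * i)%g; rewrite mulVKg; apply.
by apply/imfsetP; exists i.
Qed.

Definition bernoulli_shift : pmp_action G (lebesgue_power R cG) :=
  PmpAction shift1 shiftM measurable_shift shift_preserving.

End bernoulli_shift.

Section product_action.
Context (R : realType) (G : groupType) d1 d2 (X : measurableType d1) (Y : measurableType d2).
Context (mu : probability X R) (nu : probability Y R).
Context (a : pmp_action G mu) (b : pmp_action G nu).

Definition product_probability : probability (X * Y)%type R := (mu \x nu)%E.

Definition diagonal (g : G) (z : X * Y) : X * Y := (a g z.1, b g z.2).

Let diagonal1 z : diagonal 1%g z = z.
Proof. by case: z => x y; rewrite /diagonal !act1. Qed.

Let diagonalM g h z : diagonal (g * h)%g z = diagonal g (diagonal h z).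
Proof. by rewrite /diagonal !actM. Qed.

Let measurable_diagonal g : measurable_fun setT (diagonal g).
Proof.
apply: measurable_fun_pair.
  by apply: measurableT_comp => //; exact: measurable_act.
by apply: measurableT_comp => //; exact: measurable_act.
Qed.

Let diagonal_preserving g (A : set (X * Y)) : measurable A ->
  product_probability (diagonal g @^-1` A) = product_probability A.
Proof.
move=> mA.
pose D := distribution product_probability (mfun_Sub (mem_set (measurable_diagonal g))).
apply/esym/(product_measure_unique (m' := D)) => // B C mB mC.
rewrite /D /distribution /pushforward /=.
transitivity (product_probability (diagonal g @^-1` (B `*` C))) => //.
rewrite (_ : _ @^-1` _ = (a g @^-1` B) `*` (b g @^-1` C))//.
rewrite [LHS]product_measure1E.
- by congr (_ * _)%E; exact: act_preserving.
- by rewrite -[X in measurable X]setTI; exact: measurable_act.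
- by rewrite -[X in measurable X]setTI; exact: measurable_act.
Qed.

Definition product_action : pmp_action G product_probability :=
  PmpAction diagonal1 diagonalM measurable_diagonal diagonal_preserving.

End product_action.

Definition free_action (R : realType) (G : groupType) d (X : measurableType d)
    (mu : probability X R) (a : pmp_action G mu) : Prop :=
  {ae mu, forall x, forall g, a g x = x -> g = 1%g}.

(* The blocks of a partition are allowed to be empty. *)
Definition borel_partition d (X : measurableType d) k (A : 'I_k -> set X) : Prop :=
  [/\ forall i, measurable (A i), trivIset setT A & \bigcup_i A i = setT].

Definition weakly_contained (R : realType) (G : groupType)
    d1 (X : measurableType d1) (mu : probability X R) (a : pmp_action G mu)
    d2 (Y : measurableType d2) (nu : probability Y R) (b : pmp_action G nu) : Prop :=
  forall k (A : 'I_k -> set X), borel_partition A ->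
  forall F : set G, finite_set F -> forall e : R, 0 < e ->
  exists2 B : 'I_k -> set Y, borel_partition B &
    forall g, F g -> forall i j,
      (`| mu (a g @` A i `&` A j) - nu (b g @` B i `&` B j) | < e%:E)%E.

Definition weakly_equivalent (R : realType) (G : groupType)
    d1 (X : measurableType d1) (mu : probability X R) (a : pmp_action G mu)
    d2 (Y : measurableType d2) (nu : probability Y R) (b : pmp_action G nu) : Prop :=
  weakly_contained a b /\ weakly_contained b a.

Definition non_atomic (R : realType) d (X : measurableType d)
    (mu : probability X R) : Prop :=
  forall A, measurable A -> (0 < mu A)%E ->
  exists B, [/\ measurable B, B `<=` A, (0 < mu B)%E & (mu B < mu A)%E].

Definition polish_space (R : realType) (T : metricType R) : Prop :=
  (exists2 D : set T, countable D & dense D) /\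
  (forall F : set_system T, ProperFilter F -> cauchy F -> exists x : T, F --> x).

Definition standard_borel (R : realType) d (X : measurableType d) : Prop :=
  exists (T : metricType R) (h : X -> T),
    [/\ polish_space T, bijective h &
        measurable = preimage_set_system setT h <<s (@open T)>>].

(* Main.v *)
(* For s x a < a, cut X into finitely many small Borel pieces and give the
   pieces independent uniform colours u. Sending x to the colours of the pieces
   containing the points g^-1 x, paired with x itself, is an equivariant map
   from X to [0,1]^G x X. If D depends on finitely many coordinates only, let
   Z(u) be the measure of the preimage of D. As soon as the finitely many
   translates of x and y involved lie in distinct pieces, the names of x and y
   are independent with the right law, so the mean of Z is nearly P(D) and the
   mean of Z^2 nearly P(D)^2; the measure of the set of bad pairs (x, y) tends to
   0 when the pieces shrink, because a is free and mu has no atoms. Hence some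
   colouring works simultaneously for finitely many sets D, and every partition
   of [0,1]^G x X is close to one whose blocks depend on finitely many
   coordinates. The converse a < s x a is witnessed by the projection. *)
Require Import Defs.
From HB Require Import structures.
From mathcomp Require Import all_boot all_order all_algebra.
From mathcomp Require Import finmap zify ring lra.
From mathcomp Require Import all_classical all_reals all_analysis.
From mathcomp Require Import measurable_realfun.
Set Implicit Arguments.
Unset Strict Implicit.
Unset Printing Implicit Defensive.
Import Order.TTheory GRing.Theory Num.Theory.
Import numFieldNormedType.Exports.
Local Open Scope classical_set_scope.
Local Open Scope ring_scope.

(** * Countable separating families *)

Section separating_code.
Context d (X : measurableType d) (S : nat -> set X).

(** The level sets of [code n] are the atoms of the algebra generated by [S 0], ..., [S n.-1]. They
    form finite partitions that get finer with [n], and serve as the pieces to be coloured. *)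
Fixpoint code n (x : X) : nat :=
  if n is m.+1 then (code m x).*2 + `[< S m x >] else 0.

Lemma measurable_code n k : (forall m, measurable (S m)) ->
  measurable (code n @^-1` [set k]).
Proof.
move=> mS; elim: n k => [|n IH] k /=.
  have [->|k0] := eqVneq k 0%N.
    by rewrite (_ : _ @^-1` _ = setT)//; apply/seteqP; split.
  rewrite (_ : _ @^-1` _ = set0)//; apply/seteqP; split => // x /= /esym/eqP.
  by rewrite (negbTE k0).
rewrite (_ : _ @^-1` _ = code n @^-1` [set k./2] `&`
    (if odd k then S n else ~` S n)).
  by apply: measurableI => //; case: ifP => // _; exact: measurableC.
apply/seteqP; split => x /=.
  move=> <-; rewrite oddD odd_double oddb addFb halfD odd_double add0n doubleK.
  by case: asboolP => Sx /=; rewrite addn0.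
by case=> ->; case: ifP => ok Sx; rewrite ?(asboolT Sx) ?(asboolF Sx); lia.
Qed.

Lemma code_le m n x y : (m <= n)%N -> code n x = code n y -> code m x = code m y.
Proof.
elim: n => [|n IH]; first by rewrite leqn0 => /eqP ->.
rewrite leq_eqVlt => /predU1P[->//|mn] /= e; apply: IH => //.
by move: e; case: asboolP; case: asboolP => _ _ /=; lia.
Qed.

Lemma code_sep x y : (forall n, code n x = code n y) -> forall n, S n x <-> S n y.
Proof.
move=> e n; have /= := e n.+1; rewrite (e n).
by case: asboolP; case: asboolP => // h1 h2; lia.
Qed.

End separating_code.

Definition separating d (X : measurableType d) (S : nat -> set X) :=
  (forall n, measurable (S n)) /\ forall x y, (forall n, S n x <-> S n y) -> x = y.

(** Balls of radius [1/(j+1)] around the points of a countable dense set separate the points of a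
    metric space; the pairs of indices are coded by one integer and the balls pulled back along
    [h]. *)
Lemma standard_borel_separating (R : realType) d (X : measurableType d) :
  standard_borel R X -> exists S : nat -> set X, separating S.
Proof.
move=> [T [h [[[D cD dD] _] bij_h mE]]].
have /countable_injP[e inj_e] := cD.
(* Since [e] is injective on [D], this union has at most one term: the interior of the ball around
   the point of index [i], or the empty set when there is no such point. *)
pose U i j := \bigcup_(q in [set q | D q /\ e q = i]) (ball q (j.+1%:R^-1 : R))°.
exists (fun n => if (choice.unpickle n : option (nat * nat)) is Some (i, j) then h @^-1` U i j else set0).
split=> [n|x y xy].
  case: choice.unpickle => [[i j]|//]; rewrite mE; exists (U i j); last by rewrite setTI.
  apply: sub_sigma_algebra; apply: bigcup_open => q _; exact: open_interior.
apply: (bij_inj bij_h); apply: contrapT => hxy.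
have d0 : 0 < mdist (h x) (h y) by rewrite mdist_gt0; exact/eqP.
pose r := mdist (h x) (h y) / 2; have r0 : 0 < r by rewrite divr_gt0.
have [j jr] : exists j : nat, j.+1%:R^-1 < r.
  by exists (Num.truncn r^-1); rewrite invf_plt ?posrE//; exact: truncnS_gt.
have j0 : 0 < j.+1%:R^-1 :> R by rewrite invr_gt0.
have j20 : 0 < j.+1%:R^-1 / 2 :> R by rewrite divr_gt0.
(* The centre is taken within half the radius of [h x], so that [h x] lies in the interior of the
   ball around [q], not merely in the ball. *)
have [|q [/interior_subset xq Dq]] := dD (ball (h x) (j.+1%:R^-1 / 2 : R))° _ (open_interior _).
  by exists (h x); exact: nbhsx_ballx.
have Ux : U (e q) j (h x).
  exists q => //; apply/nbhs_ballP; exists (j.+1%:R^-1 / 2) => // z xz.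
  by rewrite [X in ball _ X](splitr j.+1%:R^-1); apply: ball_triangle xz; exact: ball_sym.
have /= := xy (choice.pickle (e q, j)); rewrite choice.pickleK => -[/(_ Ux) + _].
move=> [q' [Dq' eq'] /interior_subset q'y].
have q'q : q' = q by apply: inj_e => //; rewrite inE.
rewrite {}q'q in q'y.
have xq' : ball (h x) j.+1%:R^-1 q.
  by apply: (le_ball _ xq); rewrite ler_pdivrMr// ler_pMr// ler1n.
have := ball_triangle xq' q'y; rewrite ballEmdist/=.
have -> : mdist (h x) (h y) = r + r by rewrite -splitr.
by apply/negP; rewrite -leNgt; apply: lerD; exact: ltW.
Qed.

(** * Restrictions and products of Bernoulli measures *)

Section bernoulli_laws.
Context (R : realType).
Local Notation U := (unit_itv R).

Lemma countable_sum (I J : choiceType) : countable [set: I] -> countable [set: J] ->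
  countable [set: (I + J)%type].
Proof.
move=> /countable_injP[e inj_e] /countable_injP[f inj_f].
apply/countable_injP; exists (fun s => match s with inl i => (e i).*2 | inr j => (f j).*2.+1 end).
move=> [i|j] [i'|j'] _ _ h.
- by congr inl; apply: inj_e; rewrite ?inE//; exact: double_inj.
- by exfalso; lia.
- by exfalso; lia.
- by congr inr; apply: inj_f; rewrite ?inE//; apply: double_inj; case: h.
Qed.

Lemma measurable_preimage d1 d2 (T1 : measurableType d1) (T2 : measurableType d2)
  (f : T1 -> T2) : measurable_fun setT f ->
  forall A, measurable A -> measurable (f @^-1` A).
Proof. by move=> mf A mA; rewrite -[X in measurable X]setTI; exact: mf. Qed.

Definition pullback (I I' : Type) (T : Type) (t : I -> I') (u : power I' T) : power I T :=
  fun i => u (t i).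

Lemma measurable_pullback (I I' : Type) d (T : measurableType d) (t : I -> I') :
  measurable_fun setT (@pullback I I' T t).
Proof. by apply: measurable_power => i; exact: measurable_coordinate. Qed.

(** Coordinates read through an injection are still independent and uniform: both laws agree on
    cylinders, where injectivity keeps the factors of the product distinct. *)
Lemma lebesgue_power_pullback (I I' : choiceType) (cI : countable [set: I])
    (cI' : countable [set: I']) (t : I -> I') : injective t ->
  forall A, measurable A ->
  lebesgue_power R cI' (pullback t @^-1` A) = lebesgue_power R cI A.
Proof.
move=> inj_t A mA; pose Q := lebesgue_power R cI'.
have mt := @measurable_pullback I I' _ U t.
apply: (@power_probability_unique _ _ _ _ (@lebesgue_unit R)
  (distribution Q (mfun_Sub (mem_set mt))) (lebesgue_power R cI)) => //;
  last exact: lebesgue_powerP.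
move=> J B mB; rewrite /distribution /pushforward.
(* The constraints are carried along [t]; an index not hit by [J] gets the trivial constraint. *)
pose C k : set U := if [pick i : J | t (val i) == k] is Some i then B (val i) else setT.
have Ct i : i \in J -> C (t i) = B i.
  move=> iJ; rewrite /C; case: pickP => [j /eqP/inj_t ->//|/(_ [` iJ]%fset)].
  by rewrite /= eqxx.
transitivity (Q (cylinder [fset t i | i in J]%fset C)).
  congr (Q _); apply/seteqP; split => f /= h i.
    by move=> /imfsetP[j /= jJ ->]; rewrite Ct//; exact: h.
  by move=> iJ; rewrite -Ct//; apply: h; apply/imfsetP; exists i.
rewrite lebesgue_powerP; last by move=> k; rewrite /C; case: pickP.
rewrite big_imfset/=; last by move=> i j _ _; exact: inj_t.
by apply: eq_big_seq => i iJ; rewrite Ct.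
Qed.

Definition merge (I J T : Type) (z : power I T * power J T) : power (I + J) T :=
  fun s => match s with inl i => z.1 i | inr j => z.2 j end.

Lemma measurable_merge (I J : Type) d (T : measurableType d) :
  measurable_fun setT (@merge I J T).
Proof.
apply: measurable_power => -[i|j].
  apply: (measurableT_comp (measurable_coordinate i)); exact: measurable_fst.
apply: (measurableT_comp (measurable_coordinate j)); exact: measurable_snd.
Qed.

(** Two disjoint families of coordinates are independent. The image of the product measure under
    [merge] has the cylinder values that characterize the measure on the sum, because a cylinder
    over [K] splits into a rectangle over [KI] and [KJ]. *)
Lemma lebesgue_power_sum (I J : choiceType) (cI : countable [set: I])
    (cJ : countable [set: J]) (cIJ : countable [set: (I + J)%type]) A B :
  measurable A -> measurable B ->
  lebesgue_power R cIJ [set u | A (pullback inl u) /\ B (pullback inr u)] =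
  (lebesgue_power R cI A * lebesgue_power R cJ B)%E.
Proof.
move=> mA mB.
pose P : probability _ R := (lebesgue_power R cI \x lebesgue_power R cJ)%E.
have mm := @measurable_merge I J _ U.
transitivity (distribution P (mfun_Sub (mem_set mm))
  [set u | A (pullback inl u) /\ B (pullback inr u)]).
  apply: (@power_probability_unique _ _ _ _ (@lebesgue_unit R)) => //.
  - exact: lebesgue_powerP.
  - move=> K C mC; rewrite /distribution /pushforward.
    pose KI := [fset i in pmap (fun s : I + J => if s is inl i then Some i else None) K]%fset.
    pose KJ := [fset j in pmap (fun s : I + J => if s is inr j then Some j else None) K]%fset.
    have KIE i : (i \in KI) = (inl i \in K).
      rewrite inE mem_pmap; apply/mapP/idP => [[[j|j] // jK [->//]]|iK].
      by exists (inl i).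
    have KJE j : (j \in KJ) = (inr j \in K).
      rewrite inE mem_pmap; apply/mapP/idP => [[[i|i] // iK [->//]]|jK].
      by exists (inr j).
    transitivity (P (cylinder KI (C \o inl) `*` cylinder KJ (C \o inr))).
      congr (P _); apply/seteqP; split => -[f g] /=.
        by move=> h; split => [i|j]; rewrite ?KIE ?KJE => /h.
      by move=> [h1 h2] [i|j]; rewrite -?KIE -?KJE; [exact: h1|exact: h2].
    transitivity (lebesgue_power R cI (cylinder KI (C \o inl)) *
        lebesgue_power R cJ (cylinder KJ (C \o inr)))%E.
      by apply: product_measure1E; apply: measurable_cylinder => ?; exact: mC.
    rewrite !lebesgue_powerP; try by move=> ?; exact: mC.
    rewrite -(big_map inl xpredT (fun s => lebesgue_unit (C s))).
    rewrite -(big_map inr xpredT (fun s => lebesgue_unit (C s))) -big_cat/=.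
    apply: perm_big; apply: uniq_perm.
    - rewrite cat_uniq !map_inj_uniq ?fset_uniq ?andbT/=; try by move=> ? ? [].
      by apply/hasPn => _ /mapP[j _ ->]; apply/mapP => -[].
    - exact: fset_uniq.
    - move=> [i|j]; rewrite mem_cat -?KIE -?KJE.
        rewrite mem_map; last by move=> ? ? [].
        by rewrite [X in _ || X](_ : _ = false) ?orbF//; apply/mapP => -[].
      rewrite mem_map; last by move=> ? ? [].
      by rewrite [X in X || _](_ : _ = false)//; apply/mapP => -[].
  - apply: measurableI; apply: measurable_preimage => //; exact: measurable_pullback.
rewrite /distribution /pushforward -product_measure1E//.
Qed.
End bernoulli_laws.

(** * The random equivariant map *)

Section random_factor.
Context (R : realType) (G : groupType) (cG : countable [set: G]).
Context d (X : measurableType d) (mu : probability X R) (a : pmp_action G mu).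
Local Notation U := (unit_itv R).
Local Notation palette := (nat + (G + G))%type.

Fact palette_countable : countable [set: palette].
Proof. by apply: countable_sum; [exact: countableP|exact: countable_sum]. Qed.

Local Notation Q := (lebesgue_power R palette_countable).
Local Notation QG := (lebesgue_power R cG).
Local Notation P := (product_probability QG mu).

(* [p] cuts X into countably many pieces and [u] colours the pieces: the
   G-name of [x] reads off the colours of the pieces met by its orbit. Only the
   colours [u (inl _)] are read; the other ones are spare labels, used to make
   the relabelling in [factor_law] injective on all of [G + G]. *)
Definition lift (p : X -> nat) (u : power palette U) (x : X) : power G U :=
  fun g => u (inl (p (a g^-1%g x))).

Definition factor (p : X -> nat) (u : power palette U) (x : X) : power G U * X :=
  (lift p u x, x).

Lemma lift_act p u h x : lift p u (a h x) = shift_map h (lift p u x).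
Proof.
by apply/funext => g; rewrite /lift /shift_map -actM invgM invgK.
Qed.

Section measurability.
Variables (p : X -> nat) (mp : forall k, measurable (p @^-1` [set k])).

Lemma measurable_code_act g k : measurable [set x | p (a g x) = k].
Proof.
exact: (measurable_preimage (measurable_act a g) (mp k)).
Qed.

(** Joint measurability in the colouring and the point, needed for Tonelli. As [p] has countably
    many values, the preimage under each coordinate is a countable union of rectangles. *)
Lemma measurable_factor : measurable_fun setT (fun z => factor p z.1 z.2).
Proof.
apply: measurable_fun_pair; last exact: measurable_snd.
apply: measurable_power => g _ B mB; rewrite setTI.
rewrite (_ : _ @^-1` _ = \bigcup_k
  ((coordinate (inl k : palette) @^-1` B) `*` [set x | p (a g^-1%g x) = k])).
  apply: bigcup_measurable => k _; apply: measurableX.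
    exact: (measurable_preimage (measurable_coordinate _) mB).
  exact: measurable_code_act.
apply/seteqP; split => -[u x] /=; first by move=> Bu; exists (p (a g^-1%g x)).
by move=> [k _ [/= + xk]]; rewrite /lift xk.
Qed.

Lemma measurable_factor_u u : measurable_fun setT (factor p u).
Proof.
exact: (measurableT_comp measurable_factor (measurable_pair1 u)).
Qed.

End measurability.

Definition determined (J : {fset G}) (A : set (power G U * X)) :=
  forall f f' x, (forall g, g \in J -> f g = f' g) -> A (f, x) -> A (f', x).

Definition translate (s : G + G) (z : X * X) : X :=
  match s with inl g => a g^-1%g z.1 | inr g => a g^-1%g z.2 end.

Definition both (J : {fset G}) : {fset (G + G)} :=
  ([fset inl g | g in J] `|` [fset inr g | g in J])%fset.

Lemma in_both J s : (s \in both J) = (match s with inl g | inr g => g end \in J).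
Proof.
rewrite inE; case: s => g; apply/orP/idP => [[]/imfsetP[h /= hJ]|gJ] //.
- by case=> ->.
- by left; apply/imfsetP; exists g.
- by case=> ->.
- by right; apply/imfsetP; exists g.
Qed.

(** The two summands of [G + G] index the translates of the two points, so a single injectivity
    condition excludes collisions within each orbit and between the two orbits. *)
Definition separated (p : X -> nat) (J : {fset G}) (z : X * X) :=
  {in both J &, injective (fun s => p (translate s z))}.

(** On a separated pair, the two names restricted to [J] read pairwise distinct coordinates of [u],
    hence are independent with the Bernoulli law. *)
Lemma factor_law p J A B x y : measurable A -> measurable B ->
  determined J A -> determined J B -> separated p J (x, y) ->
  Q [set u | A (factor p u x) /\ B (factor p u y)] =
  (QG (ysection A x) * QG (ysection B y))%E.
Proof.
move=> mA mB JA JB sep.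
have cGG : countable [set: (G + G)%type] by exact: countable_sum.
pose t (s : G + G) : palette := match s with
  | inl g => if g \in J then inl (p (a g^-1%g x)) else inr (inl g)
  | inr g => if g \in J then inl (p (a g^-1%g y)) else inr (inr g) end.
have inj_t : injective t.
  have e s s' : s \in both J -> s' \in both J ->
      p (translate s (x, y)) = p (translate s' (x, y)) -> s = s' by exact: sep.
  move=> [g|g] [g'|g']; rewrite /t; case: ifPn => gJ; case: ifPn => g'J //.
  - by case=> h; apply: e; rewrite ?in_both.
  - by case=> ->.
  - by case=> h; apply: e; rewrite ?in_both.
  - by case=> h; apply: e; rewrite ?in_both.
  - by case=> h; apply: e; rewrite ?in_both.
  - by case=> ->.
(* The product becomes the measure of one event over [G + G], which [t] transports to the palette.
   The events then coincide, since [A] and [B] only see coordinates in [J]. *)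
rewrite -(lebesgue_power_sum cG cG cGG); [|exact: measurable_ysection..].
rewrite -(lebesgue_power_pullback cGG palette_countable inj_t); last first.
  apply: measurableI; (apply: measurable_preimage; first exact: measurable_pullback);
    exact: measurable_ysection.
congr (Q _); apply/seteqP; split => u /= -[].
  move=> Au Bu; split; apply/ysectionP.
    by apply: JA Au => g gJ; rewrite /lift /pullback /= gJ.
  by apply: JB Bu => g gJ; rewrite /lift /pullback /= gJ.
move=> /ysectionP Au /ysectionP Bu; split.
  by apply: JA Au => g gJ; rewrite /lift /pullback /= gJ.
by apply: JB Bu => g gJ; rewrite /lift /pullback /= gJ.
Qed.

End random_factor.

(** * Second moments *)

Section product_measure_facts.
Local Open Scope ereal_scope.
Context (R : realType) d1 d2 (X : measurableType d1) (Y : measurableType d2).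
Variables (mu : probability X R) (nu : probability Y R).

(** Tonelli for sets: the two sides integrate the sections in the two possible orders. *)
Lemma product_measure12 A : measurable A -> (mu \x nu) A = (mu \x^ nu) A.
Proof.
move=> mA; apply: product_measure_unique => // B C mB mC; exact: product_measure2E.
Qed.

End product_measure_facts.

Lemma product_integralM (R : realType) d (X : measurableType d) (mu : probability X R)
    (f g : X -> \bar R) :
  measurable_fun setT f -> measurable_fun setT g ->
  (forall x, 0 <= f x)%E -> (forall x, 0 <= g x)%E ->
  (\int[mu \x mu]_z (f z.1 * g z.2) = (\int[mu]_x f x) * (\int[mu]_x g x))%E.
Proof.
move=> mf mg f0 g0.
have mfg : measurable_fun setT (fun z : X * X => f z.1 * g z.2)%E.
  apply: emeasurable_funM; apply: measurableT_comp => //.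
rewrite (fubini_tonelli1 _ mfg) => [|z]; last exact: mule_ge0.
transitivity (\int[mu]_x (f x * \int[mu]_y g y))%E.
  by apply: eq_integral => x _; rewrite /fubini_F/= ge0_integralZl.
by rewrite ge0_integralZr// integral_ge0.
Qed.

(** * Mean over the colouring of a product of two preimage measures *)

Section correlation.
Context (R : realType) (G : groupType) (cG : countable [set: G]).
Context d (X : measurableType d) (mu : probability X R) (a : pmp_action G mu).
Local Notation U := (unit_itv R).
Local Notation Q := (lebesgue_power R (palette_countable cG)).
Local Notation QG := (lebesgue_power R cG).
Local Notation P := (product_probability QG mu).
Local Open Scope ereal_scope.

Variables (p : X -> nat) (mp : forall k, measurable (p @^-1` [set k])).
Variables (J : {fset G}) (A B : set (power G U * X)).
Hypotheses (mA : measurable A) (mB : measurable B).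
Hypotheses (JA : determined J A) (JB : determined J B).
Variables (N : set (X * X)) (mN : measurable N).
Hypothesis sepN : forall z, ~ N z -> separated a p J z.

Let E := [set z : power (nat + (G + G)) U * (X * X) |
  A (factor a p z.1 z.2.1) /\ B (factor a p z.1 z.2.2)].

Let mE : measurable E.
Proof.
have mf := measurable_factor a mp.
pose Z := (power (nat + (G + G)) U * (X * X))%type.
have m1 : measurable_fun setT (fun z : Z => (z.1, z.2.1)).
  apply: measurable_fun_pair; first exact: measurable_fst.
  exact: (measurableT_comp measurable_fst measurable_snd).
have m2 : measurable_fun setT (fun z : Z => (z.1, z.2.2)).
  apply: measurable_fun_pair; first exact: measurable_fst.
  exact: (measurableT_comp measurable_snd measurable_snd).
apply: measurableI.
  exact: (measurable_preimage (measurableT_comp mf m1) mA).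
exact: (measurable_preimage (measurableT_comp mf m2) mB).
Qed.

(** For a fixed colouring the integrand is the measure of a rectangle, namely the section of [E] at
    [u]; Tonelli then slices [E] by pairs of points instead. *)
Let integral_QE :
  \int[Q]_u (mu (factor a p u @^-1` A) * mu (factor a p u @^-1` B)) =
  \int[(mu \x mu)]_z Q (ysection E z).
Proof.
transitivity ((Q \x (mu \x mu)) E).
  apply: eq_integral => u _ /=.
  have mf := measurable_preimage (measurable_factor_u a mp u).
  rewrite -[LHS](product_measure1E mu mu (mf _ mA) (mf _ mB)).
  congr ((mu \x mu) _); apply/seteqP; split => -[x y] /=.
    by move=> [Ax By]; apply/xsectionP.
  by move=> /xsectionP.
exact: (product_measure12 _ _ mE).
Qed.

Let integral_PP :
  \int[(mu \x mu)]_z (QG (ysection A z.1) * QG (ysection B z.2)) = P A * P B.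
Proof.
have h := @product_integralM R d X mu (fun x => QG (ysection A x)) (fun x => QG (ysection B x)).
rewrite h//; try exact: measurable_fun_ysection.
by congr (_ * _); apply/esym/product_measure12.
Qed.

Let mQE : measurable_fun setT (fun z => Q (ysection E z)).
Proof. exact: measurable_fun_ysection. Qed.

Let mQAB : measurable_fun setT
  (fun z : X * X => QG (ysection A z.1) * QG (ysection B z.2)).
Proof.
apply: emeasurable_funM.
  apply: (measurableT_comp (f := fun x => QG (ysection A x)) _ measurable_fst).
  exact: measurable_fun_ysection.
apply: (measurableT_comp (f := fun x => QG (ysection B x)) _ measurable_snd).
exact: measurable_fun_ysection.
Qed.

Let QE_sep z : ~ N z -> Q (ysection E z) = QG (ysection A z.1) * QG (ysection B z.2).
Proof.
case: z => x y /sepN sz; rewrite -(factor_law cG mA mB JA JB sz).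
congr (Q _); apply/seteqP; split => u /=; first by move=> /ysectionP.
by move=> h; apply/ysectionP.
Qed.

(** Off [N] the two integrands over pairs coincide by [factor_law]; on [N] the left one is at most
    1, which costs the measure of [N]. With [A = B] this bounds the second moment. *)
Lemma correlation_le :
  \int[Q]_u (mu (factor a p u @^-1` A) * mu (factor a p u @^-1` B)) <=
  P A * P B + (mu \x mu) N.
Proof.
have iN : (mu \x mu) N = \int[(mu \x mu)]_z (\1_N z)%:E.
  by rewrite integral_indic// setIT.
rewrite integral_QE -integral_PP iN -ge0_integralD//.
- apply: ge0_le_integral => //.
    by apply: emeasurable_funD => //; apply/measurable_EFinP.
  move=> z _; have [Nz|Nz] := pselect (N z).
    rewrite indicE mem_set//; apply: (@le_trans _ _ 1); first by apply: probability_le1; exact: measurable_ysection.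
    by rewrite leeDr// mule_ge0.
  by rewrite QE_sep// leeDl// lee_fin.
- by move=> z _; rewrite mule_ge0.
- by apply/measurable_EFinP.
Qed.

(** The same comparison in the other direction. With [B] the whole space it bounds the first moment
    from below. *)
Lemma le_correlation :
  P A * P B <=
  \int[Q]_u (mu (factor a p u @^-1` A) * mu (factor a p u @^-1` B)) + (mu \x mu) N.
Proof.
have iN : (mu \x mu) N = \int[(mu \x mu)]_z (\1_N z)%:E.
  by rewrite integral_indic// setIT.
rewrite integral_QE -integral_PP iN -ge0_integralD//.
- apply: ge0_le_integral => //.
  + by move=> z _; rewrite mule_ge0.
  + by apply: emeasurable_funD => //; apply/measurable_EFinP.
  move=> z _; have [Nz|Nz] := pselect (N z).
    rewrite indicE mem_set//; apply: (@le_trans _ _ 1); last by rewrite leeDr.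
    rewrite -[leRHS]mule1; apply: lee_pmul => //; apply: probability_le1;
      exact: measurable_ysection.
  by rewrite QE_sep// leeDl// lee_fin.
- by apply/measurable_EFinP.
Qed.

End correlation.

Lemma probability_integral_cst (R : realType) d (T : measurableType d)
  (Q : probability T R) (r : \bar R) : (\int[Q]_u r = r)%E.
Proof.
rewrite (integral_cst Q measurableT r); transitivity (r * 1)%E; last by rewrite mule1.
by congr (_ * _)%E; exact: probability_setT.
Qed.

(* If no [u] works, then [e^2 + \sum 2 c_i z_i <= \sum (z_i^2 + c_i^2)] holds
   pointwise; both sides are nonnegative, and integrating gives
   [e^2 <= #|I| (b + 2 b c) <= 3 #|I| b]. *)
Lemma second_moment (R : realType) d (T : measurableType d) (Q : probability T R)
    (I : finType) (z : I -> T -> R) (c : I -> R) (b e : R) :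
  (forall i, measurable_fun setT (z i)) -> (forall i u, 0 <= z i u <= 1) ->
  (forall i, 0 <= c i <= 1) -> 0 <= b -> 0 < e ->
  (forall i, (c i)%:E <= \int[Q]_u (z i u)%:E + b%:E)%E ->
  (forall i, \int[Q]_u ((z i u)%:E * (z i u)%:E) <= (c i * c i + b)%:E)%E ->
  #|I|%:R * (3 * b) < e ^+ 2 ->
  exists u, forall i, `|z i u - c i| < e.
Proof.
move=> mz z01 c01 b0 e0 cz zz Ib; apply: contrapT => noz.
have mzE i : measurable_fun setT (fun u => (z i u)%:E) by apply/measurable_EFinP.
have z0 i u : (0 <= (z i u)%:E)%E by rewrite lee_fin; have /andP[] := z01 i u.
have c0 i : 0 <= c i by have /andP[] := c01 i.
have [r rE] : exists r : I -> R, forall i, (\int[Q]_u (z i u)%:E = (r i)%:E)%E.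
  suff h i : (\int[Q]_u (z i u)%:E)%E \is a fin_num.
    by exists (fun i => fine (\int[Q]_u (z i u)%:E)%E) => i; rewrite fineK.
  rewrite ge0_fin_numE; last exact: integral_ge0.
  apply: (@le_lt_trans _ _ (\int[Q]_u 1)%E).
    apply: ge0_le_integral => // u _; rewrite lee_fin.
    by have /andP[] := z01 i u.
  by rewrite probability_integral_cst ltry.
have [t tE] : exists t : I -> R, forall i, (\int[Q]_u ((z i u)%:E * (z i u)%:E) = (t i)%:E)%E.
  suff h i : (\int[Q]_u ((z i u)%:E * (z i u)%:E))%E \is a fin_num.
    by exists (fun i => fine (\int[Q]_u ((z i u)%:E * (z i u)%:E))%E) => i; rewrite fineK.
  rewrite ge0_fin_numE; last by apply: integral_ge0 => u _; rewrite mule_ge0.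
  by apply: le_lt_trans (zz i) _; exact: ltry.
have key : (\int[Q]_u ((e ^+ 2)%:E + \sum_(i in I) ((2 * c i)%:E * (z i u)%:E)) <=
    \int[Q]_u \sum_(i in I) ((z i u)%:E * (z i u)%:E + (c i * c i)%:E))%E.
  apply: ge0_le_integral => //.
  - move=> u _; rewrite adde_ge0// ?lee_fin ?sqr_ge0//.
    by apply: sume_ge0 => i _; rewrite mule_ge0// lee_fin mulr_ge0.
  - apply: emeasurable_funD => //; apply: emeasurable_sum => i _.
    exact: measurable_funeM.
  - apply: emeasurable_sum => i _; apply: emeasurable_funD => //.
    exact: emeasurable_funM.
  move=> u _; have [i ei] : exists i, e <= `|z i u - c i|.
    apply: contrapT => h; apply: noz; exists u => i; rewrite ltNge.
    by apply/negP => ?; apply: h; exists i.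
  under eq_bigr do rewrite -EFinM.
  under [X in (_ <= X)%E]eq_bigr do rewrite -EFinM -EFinD.
  rewrite !sumEFin -EFinD lee_fin -lerBrDr -sumrB.
  apply: (@le_trans _ _ ((z i u - c i) ^+ 2)).
    by rewrite -[leRHS]real_normK ?num_real// ler_sqr ?nnegrE// ltW.
  rewrite [leRHS](eq_bigr (fun j => (z j u - c j) ^+ 2)); last by move=> j _; ring.
  by rewrite (bigD1 i)//= lerDl; apply: sumr_ge0 => j _; exact: sqr_ge0.
have : e ^+ 2 + \sum_(i in I) (2 * c i * r i) <= \sum_(i in I) (t i + c i * c i).
  rewrite -lee_fin EFinD -!sumEFin; move: key.
  have m2cz i : measurable_fun setT (fun u => (2 * c i)%:E * (z i u)%:E)%E.
    exact: measurable_funeM.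
  have cz0 i u : (0 <= (2 * c i)%:E * (z i u)%:E)%E.
    by rewrite mule_ge0// lee_fin mulr_ge0.
  rewrite ge0_integralD//; last first.
  - exact: emeasurable_sum.
  - by move=> u _; exact: sume_ge0.
  - by move=> u _; rewrite lee_fin sqr_ge0.
  rewrite !ge0_integral_sum//.
  - rewrite probability_integral_cst.
    under eq_bigr do rewrite ge0_integralZl// ?lee_fin ?mulr_ge0// rE -EFinM.
    under [X in (_ <= X)%E -> _]eq_bigr => i _.
      rewrite ge0_integralD//.
      + rewrite tE probability_integral_cst -EFinD; over.
      + by move=> u _; rewrite mule_ge0.
      + exact: emeasurable_funM.
      + by move=> u _; rewrite lee_fin mulr_ge0.
    by [].
  - by move=> i; apply: emeasurable_funD => //; exact: emeasurable_funM.
  - by move=> i u _; rewrite adde_ge0// ?mule_ge0// lee_fin mulr_ge0.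
apply/negP; rewrite -ltNge -ltrBlDr -sumrB; apply: le_lt_trans Ib.
rewrite mulr_natl -sumr_const; apply: ler_sum => i _.
have := cz i; rewrite rE -EFinD lee_fin => h1.
have := zz i; rewrite tE lee_fin => h2.
have /andP[_ c1] := c01 i; have := c0 i.
by nra.
Qed.

(** * Separation of orbit points *)

Section separation.
Context (R : realType) (G : groupType) (cG : countable [set: G]).
Context d (X : measurableType d) (mu : probability X R) (a : pmp_action G mu).
Variables (S : nat -> set X) (sepS : separating S) (mu_non_atomic : non_atomic mu).
Hypothesis a_free : free_action a.

Let mS n : measurable (S n). Proof. by case: sepS. Qed.

Lemma code_inj x y : (forall n, code S n x = code S n y) -> x = y.
Proof. by move=> h; case: sepS => _; apply; exact: code_sep. Qed.

Lemma measurable_singleton x : measurable ([set x] : set X).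
Proof.
rewrite (_ : [set x] = \bigcap_n (code S n @^-1` [set code S n x])).
  by apply: bigcap_measurable => // n _; exact: measurable_code.
by apply/seteqP; split => y /= => [->//|h]; apply: code_inj => n; exact: h.
Qed.

(** A singleton of positive measure would be an atom: its only subsets are itself and the empty
    set. *)
Lemma singleton_null x : mu [set x] = 0%E.
Proof.
apply: contrapT => /eqP x0.
have [|B [mB Bx B0 Bltx]] := mu_non_atomic (measurable_singleton x).
  by rewrite lt0e x0 measure_ge0.
have [xB|xB] := pselect (B x).
  have BE : B = [set x] by apply/seteqP; split => // _ ->.
  by move: Bltx; rewrite BE ltxx.
have BE : B = set0 by rewrite -subset0 => y By; apply: xB; rewrite -(Bx _ By).
by move: B0; rewrite BE measure0 ltxx.
Qed.

Definition unseparated n (J : {fset G}) : set (X * X) :=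
  [set z | ~ separated a (code S n) J z].

Let collision n (s s' : G + G) : set (X * X) :=
  [set z | code S n (translate a s z) = code S n (translate a s' z)].

Let unseparatedE n J : unseparated n J =
  \bigcup_(s in [set` both J]) \bigcup_(s' in [set` both J] `&` [set~ s]) collision n s s'.
Proof.
apply/seteqP; split => z.
  move=> h; apply: contrapT => h'; apply: h => s s' sJ s'J e.
  by apply: contrapT => ss'; apply: h'; exists s => //; exists s' => //; split => // /esym.
by move=> [s sJ [s' [s'J ss'] e]] h; apply: ss'; exact/esym/(h s s').
Qed.

Lemma measurable_translate s k n : measurable (translate a s @^-1` (code S n @^-1` [set k])).
Proof.
case: s => g; (apply: measurable_preimage; last exact: measurable_code).
  exact: (measurableT_comp (measurable_act a g^-1%g) measurable_fst).
exact: (measurableT_comp (measurable_act a g^-1%g) measurable_snd).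
Qed.

Lemma measurable_unseparated n J : measurable (unseparated n J).
Proof.
have fin : finite_set [set` both J] by exact: finite_fset.
rewrite unseparatedE; apply: fin_bigcup_measurable => // s _.
apply: fin_bigcup_measurable => [|s' _]; first exact: finite_setIl.
rewrite (_ : collision n s s' = \bigcup_k
   (translate a s @^-1` (code S n @^-1` [set k]) `&`
    translate a s' @^-1` (code S n @^-1` [set k]))).
  by apply: bigcup_measurable => k _; apply: measurableI; exact: measurable_translate.
apply/seteqP; split => z /=; first by move=> e; exists (code S n (translate a s z)).
by move=> [k _ [/= h1 h2]]; exact: etrans h1 (esym h2).
Qed.

Lemma unseparated_decreasing J : nonincreasing_seq (unseparated ^~ J).
Proof.
move=> m n mn; apply/subsetPset => z; rewrite /unseparated /=; apply: contra_not => h s s' sJ s'J e.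
by apply: (h _ _ sJ s'J); exact: code_le e.
Qed.

(** If all translates of the pair were distinct, each two of them would get different codes at some
    stage; the largest of the finitely many stages needed for [both J] would separate [z]. *)
Lemma bigcap_unseparated J z : (\bigcap_n unseparated n J) z ->
  exists s s', s <> s' /\ translate a s z = translate a s' z.
Proof.
move=> hz; apply: contrapT => h.
have [n hn] : exists n : G + G -> G + G -> nat, forall s s', s <> s' ->
    code S (n s s') (translate a s z) <> code S (n s s') (translate a s' z).
  suff: forall i : (G + G) * (G + G), exists n : nat, i.1 <> i.2 ->
      code S n (translate a i.1 z) <> code S n (translate a i.2 z).
    by move=> /choice[n hn]; exists (fun s s' => n (s, s')) => s s'; exact: hn (s, s').
  move=> [s s'] /=; apply: contrapT => hn.
  (* For equal indices nothing is required, and the stage 0 is a dummy value. *)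
  have [ss'|ss'] := pselect (s = s'); first by apply: hn; exists 0%N.
  apply: h; exists s, s'; split => //; apply: code_inj => n; apply: contrapT => e.
  by apply: hn; exists n.
pose K := both J.
pose N := \max_(s <- K) \max_(s' <- K) n s s'.
apply: (hz N I) => s s' sK s'K e; apply: contrapT => ss'.
apply: (hn _ _ ss'); apply: code_le e; rewrite /N.
apply: (@leq_trans (\max_(s' <- K) n s s')).
  exact: (@leq_bigmax_seq _ _ xpredT (n s)).
exact: (@leq_bigmax_seq _ _ xpredT (fun s => \max_(s' <- K) n s s')).
Qed.

Lemma orbit_null x : mu.-negligible (range (a ^~ x)).
Proof.
have /countable_injP[e inj_e] := cG.
apply: (@negligibleS _ _ _ _ (\bigcup_k [set y | exists2 g, e g = k & y = a g x])).
  by move=> _ [g _ <-]; exists (e g) => //; exists g.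
apply: negligible_bigcup => k.
have [[g gk]|nk] := pselect (exists g, e g = k).
  exists [set a g x]; split; [exact: measurable_singleton|exact: singleton_null|].
  by move=> y [h hk ->] /=; congr (a _ x); apply: inj_e; rewrite ?inE// hk.
apply: (@negligibleS _ _ _ _ set0); last exact: negligible_set0.
by move=> y [g gk _]; apply: nk; exists g.
Qed.

(** Two translates of the pair coincide. If both come from the same point, freeness fails there,
    which happens only on a null set; otherwise [y] lies in the orbit of [x], which is countable and
    hence null. So almost every section is null. *)
Lemma bigcap_unseparated_null J : ((mu \x mu) (\bigcap_n unseparated n J) = 0)%E.
Proof.
have mL : measurable (\bigcap_n unseparated n J).
  by apply: bigcap_measurable => // n _; exact: measurable_unseparated.
set L := (X in _ X) in mL *.
have [N0 [mN0 N00 subN0]] := a_free.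
(* Trivial stabilizer is turned into injectivity of the orbit map by applying it to [h^-1 * g]. *)
have freeN x : ~ N0 x -> forall g h, a g x = a h x -> g = h.
  move=> N0x g h gh; apply: (mulgI h^-1%g); rewrite mulVg.
  have /contrapT free_x : ~ ~ (forall g, a g x = x -> g = 1%g).
    by move=> /subN0.
  by apply: free_x; rewrite actM gh -actM mulVg act1.
rewrite /product_measure1.
transitivity (\int[mu]_x (0 : \bar R))%E; last by rewrite integral0.
apply: ge0_ae_eq_integral => //; first exact: measurable_fun_xsection.
exists N0; split => // x /= hx; apply: contrapT => N0x; apply: hx => _.
apply: measure_negligible; first exact: measurable_xsection.
apply: (@negligibleS _ _ _ _ (N0 `|` range (a ^~ x))); last first.
  apply: negligibleU; last exact: orbit_null.
  by apply/negligibleP.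
move=> y /xsectionP /bigcap_unseparated[s [s' [ss']]].
have [N0y _|N0y] := pselect (N0 y); first by left.
case: s s' ss' => [g|g] [g'|g'] ss' /= e.
- by case: ss'; congr inl; apply: invg_inj; exact: (freeN x).
- by right; exists (g' * g^-1)%g => //; rewrite actM e -actM mulgV act1.
- by right; exists (g * g'^-1)%g => //; rewrite actM -e -actM mulgV act1.
- by case: ss'; congr inr; apply: invg_inj; exact: (freeN y).
Qed.

(** Continuity from above: the sets decrease with [n] to a null set. *)
Lemma unseparated_small J (b : R) : 0 < b ->
  exists n, ((mu \x mu) (unseparated n J) < b%:E)%E.
Proof.
move=> b0.
have mL : measurable (\bigcap_n unseparated n J).
  by apply: bigcap_measurable => // n _; exact: measurable_unseparated.
have := @nonincreasing_cvg_mu _ _ _ (product_probability mu mu) _ _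
  (fun n => measurable_unseparated n J) mL (@unseparated_decreasing J).
rewrite [X in _ --> X]bigcap_unseparated_null.
have oo : (product_probability mu mu (unseparated 0 J) < +oo)%E.
  by apply: le_lt_trans (ltry 1); apply: probability_le1; exact: measurable_unseparated.
move=> /(_ oo) /(_ [set x | (x < b%:E)%E]) [|n _ /(_ n (leqnn n))]; last by exists n.
by apply: open_nbhs_nbhs; split; [exact: open_ereal_lt_ereal|rewrite /= lte_fin].
Qed.

End separation.

(** * One colouring that is good for finitely many sets *)

Section approximate_factor.
Context (R : realType) (G : groupType) (cG : countable [set: G]).
Context d (X : measurableType d) (mu : probability X R) (a : pmp_action G mu).
Variables (S : nat -> set X) (sepS : separating S) (mu_non_atomic : non_atomic mu).
Hypothesis a_free : free_action a.
Local Notation U := (unit_itv R).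
Local Notation P := (product_probability (lebesgue_power R cG) mu).

(** [second_moment] is applied to the preimage measures as random variables in [u]; the two
    correlation bounds supply its hypotheses, with [b] bounding the measure of the unseparated
    pairs. *)
Lemma approximate_factor (I : finType) (D : I -> set (power G U * X)) (J : {fset G}) (e : R) :
  (forall i, measurable (D i)) -> (forall i, determined J (D i)) -> 0 < e ->
  exists n u, forall i,
    `|fine (mu (factor a (code S n) u @^-1` D i)) - fine (P (D i))| < e.
Proof.
move=> mD JD e0.
have mS n : measurable (S n) by case: sepS.
(* Chosen so that [#|I| * 3 * b < e ^ 2]; the added 1 makes this strict and covers an empty [I]. *)
pose b := e ^+ 2 / (#|I|%:R * 3 + 1).
have I0 : 0 < #|I|%:R * 3 + 1 :> R by rewrite ltr_wpDl// mulr_ge0.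
have b0 : 0 < b by rewrite divr_gt0// exprn_gt0.
have [n nb] := unseparated_small cG sepS mu_non_atomic a_free J b0.
have mp k : measurable (code S n @^-1` [set k]) by exact: measurable_code.
have mB := measurable_unseparated a sepS n J.
have sepB z : ~ unseparated a S n J z -> separated a (code S n) J z.
  by move=> /contrapT.
pose Q := lebesgue_power R (palette_countable cG).
pose z i u := fine (mu (factor a (code S n) u @^-1` D i)).
have mf i u : measurable (factor a (code S n) u @^-1` D i).
  exact: (measurable_preimage (measurable_factor_u a mp u) (mD i)).
have zE i u : (z i u)%:E = mu (factor a (code S n) u @^-1` D i).
  by rewrite fineK// fin_num_measure.
have PE i : (fine (P (D i)))%:E = P (D i) by rewrite fineK// fin_num_measure.
have z01 i u : 0 <= z i u <= 1.
  by rewrite -!lee_fin zE measure_ge0 probability_le1.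
have c01 i : 0 <= fine (P (D i)) <= 1.
  by rewrite -!lee_fin PE measure_ge0 probability_le1.
suff [u hu] : exists u, forall i, `|z i u - fine (P (D i))| < e by exists n, u.
apply: (second_moment (Q := Q) (b := b)) => //.
- move=> i; apply/measurable_EFinP.
  rewrite (_ : _ \o _ = mu \o xsection
    ((fun w => factor a (code S n) w.1 w.2) @^-1` D i)).
    apply: measurable_fun_xsection.
    exact: (measurable_preimage (measurable_factor a mp) (mD i)).
  apply/funext => u /=; rewrite zE; congr (mu _).
  by apply/seteqP; split => x /=; [move=> h; apply/xsectionP|move=> /xsectionP].
- exact: ltW.
- move=> i; rewrite PE.
  have JT : determined J [set: power G U * X] by [].
  have := le_correlation cG mp (mD i) measurableT (JD i) JT mB sepB.
  rewrite [X in (_ * X)%E](probability_setT P) mule1 => /le_trans; apply.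
  apply: leeD; last exact: ltW.
  rewrite le_eqVlt; apply/orP; left; apply/eqP; apply: eq_integral => u _.
  by rewrite zE preimage_setT; transitivity (mu (factor a (code S n) u @^-1` D i) * 1)%E;
    [congr (_ * _)%E; exact: probability_setT|rewrite mule1].
- move=> i.
  under eq_integral do rewrite zE.
  apply: (le_trans (correlation_le cG mp (mD i) (mD i) (JD i) (JD i) mB sepB)).
  by rewrite EFinD EFinM PE; apply: leeD => //; exact: ltW.
- rewrite /b mulrA mulrA (mulrC _ (e ^+ 2)) -mulrA -[ltRHS]mulr1 ltr_pM2l ?exprn_gt0//.
  by rewrite ltr_pdivrMr// mul1r ltrDl.
Qed.

End approximate_factor.

(** * Approximation by an algebra of sets *)

Section approximation.
Context (R : realType) d (T : measurableType d) (P : probability T R).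
Variable (C : set (set T)).
Hypotheses (mC : C `<=` measurable) (C0 : C set0) (CC : setC_closed C) (CU : setU_closed C).

Definition symdiff (A B : set T) := (A `\` B) `|` (B `\` A).

Lemma measurable_symdiff A B : measurable A -> measurable B -> measurable (symdiff A B).
Proof. by move=> mA mB; apply: measurableU; exact: measurableD. Qed.

Lemma symdiff_subset A V B : V `<=` A -> symdiff A B `<=` (A `\` V) `|` symdiff V B.
Proof.
move=> VA x [[Ax Bx]|[Bx Ax]].
  by have [Vx|Vx] := pselect (V x); [right; left|left].
by right; right; split => // /VA.
Qed.

Definition approximable := [set A | measurable A /\
  forall e : R, 0 < e -> exists2 B, C B & (P (symdiff A B) < e%:E)%E].

Lemma measure_leU A A1 A2 : measurable A -> measurable A1 -> measurable A2 ->
  A `<=` A1 `|` A2 -> (P A <= P A1 + P A2)%E.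
Proof.
move=> mA mA1 mA2 AA; apply: le_trans (measureU2 _ mA1 mA2).
by apply: le_measure; rewrite ?inE//; exact: measurableU.
Qed.

Lemma approximableW A : C A -> approximable A.
Proof.
move=> CA; split; first exact: mC.
move=> e e0; exists A => //; rewrite /symdiff setDv setU0 measure0.
by rewrite lte_fin.
Qed.

Lemma approximableU A B : approximable A -> approximable B -> approximable (A `|` B).
Proof.
move=> [mA aA] [mB aB]; split; first exact: measurableU.
move=> e e0; have e20 : 0 < e / 2 by rewrite divr_gt0.
have [A' CA' hA] := aA _ e20; have [B' CB' hB] := aB _ e20.
exists (A' `|` B'); first exact: CU.
have mA' := mC CA'; have mB' := mC CB'.
have := lteD hA hB; rewrite -EFinD -splitr; apply: le_lt_trans.
apply: measure_leU; try by apply: measurable_symdiff => //; exact: measurableU.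
by rewrite /symdiff => x /=; tauto.
Qed.

(** Half of [e] pays for truncating to a finite union [V n], by continuity from above of the
    remainders, and half for approximating [V n]. *)
Lemma approximable_bigcup (F : nat -> set T) :
  (forall n, approximable (F n)) -> approximable (\bigcup_n F n).
Proof.
move=> aF; have mF n : measurable (F n) by case: (aF n).
have mA : measurable (\bigcup_n F n) by exact: bigcupT_measurable.
split => // e e0; have e20 : 0 < e / 2 by rewrite divr_gt0.
pose V n := \big[setU/set0]_(i < n) F i.
have aV n : approximable (V n).
  rewrite /V; elim: n => [|n IH]; first by rewrite big_ord0; exact: approximableW.
  by rewrite big_ord_recr/=; exact: approximableU.
have mV n : measurable (V n) by case: (aV n).
have mAV n : measurable (\bigcup_n F n `\` V n) by exact: measurableD.
have nAV : nonincreasing_seq (fun n => \bigcup_n F n `\` V n).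
  move=> m n mn; apply/subsetPset; apply: setDS; exact: subset_bigsetU.
have AV0 : \bigcap_n (\bigcup_n F n `\` V n) = set0.
  rewrite -subset0 => x h; have [[n _ Fx] _] := h 0%N I.
  have [_] := h n.+1 I; apply; rewrite /V big_ord_recr/=; by right.
have [n hn] : exists n, (P (\bigcup_n F n `\` V n) < (e / 2)%:E)%E.
  have := @nonincreasing_cvg_mu _ _ _ P _ _ mAV _ nAV.
  rewrite AV0 measure0 => h.
  have oo : (P (\bigcup_n F n `\` V 0%N) < +oo)%E.
    by apply: le_lt_trans (ltry 1); exact: probability_le1.
  move: (h oo measurable0) => /(_ [set x | (x < (e / 2)%:E)%E]) [|n _ /(_ n (leqnn n))]; last by exists n.
  by apply: open_nbhs_nbhs; split; [exact: open_ereal_lt_ereal|rewrite /= lte_fin].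
have [B CB hB] := (aV n).2 _ e20; exists B => //.
have mB := mC CB.
have := lteD hn hB; rewrite -EFinD -splitr; apply: le_lt_trans.
apply: measure_leU => //; try exact: measurable_symdiff.
apply: symdiff_subset; rewrite /V -bigcup_mkord => x [i _ Fx]; by exists i.
Qed.

(** Consequently every set of the sigma-algebra generated by [C] is approximable. Complements cost
    nothing, as they leave symmetric differences unchanged. *)
Lemma sigma_algebra_approximable : sigma_algebra setT approximable.
Proof.
split; [exact: approximableW| |exact: approximable_bigcup].
move=> A [mA aA]; split; first by rewrite setTD; exact: measurableC.
move=> e e0; have [B CB hB] := aA _ e0; exists (~` B); first exact: CC.
rewrite (_ : symdiff _ _ = symdiff A B)// setTD.
apply/seteqP; split => x; rewrite /symdiff /=;
  have [] := pselect (A x); have [] := pselect (B x); tauto.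
Qed.

End approximation.

(** * Approximation of whole partitions *)

Section partition_approximation.
Context (R : realType) d (T : measurableType d) (P : probability T R).
Variable (C : set (set T)).
Hypotheses (mC : C `<=` measurable) (C0 : C set0) (CC : setC_closed C) (CU : setU_closed C).

Lemma probability_bigsetU_le (I : Type) (s : seq I) (F : I -> set T) :
  (forall i, measurable (F i)) ->
  (P (\big[setU/set0]_(i <- s) F i) <= \sum_(i <- s) P (F i))%E.
Proof.
move=> mF; elim: s => [|i s IH]; first by rewrite !big_nil measure0.
rewrite !big_cons; apply: (@le_trans _ _ (P (F i) + P (\big[setU/set0]_(i <- s) F i))%E).
  by apply: measureU2 => //; exact: bigsetU_measurable.
exact: leeD2l.
Qed.

Lemma setU_closed_big (I : Type) (s : seq I) (p : pred I) (F : I -> set T) :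
  (forall i, C (F i)) -> C (\big[setU/set0]_(i <- s | p i) F i).
Proof. by move=> CF; elim/big_ind : _. Qed.

Lemma setI_closed_big (I : Type) (s : seq I) (F : I -> set T) :
  (forall i, C (F i)) -> C (\big[setI/setT]_(i <- s) F i).
Proof.
move=> CF; have CT : C setT by rewrite -setC0; exact: CC.
elim/big_ind : _ => // A B CA CB; rewrite -(setCK (A `&` B)) setCI.
by apply: CC; apply: CU; exact: CC.
Qed.

(** Such a set is a Boolean combination of the [F i]: the union, over the finitely many patterns
    accepted by [p], of the corresponding atoms. *)
Lemma setUC_closed_pattern (I : finType) (F : I -> set T) (p : pred {ffun I -> bool}) :
  (forall i, C (F i)) -> C [set z | p [ffun i => `[< F i z >]]].
Proof.
move=> CF; rewrite (_ : mkset _ = \big[setU/set0]_(v : {ffun I -> bool} | p v)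
    \big[setI/setT]_(i : I) (if v i then F i else ~` F i)).
  apply: setU_closed_big => v; apply: setI_closed_big => i.
  by case: ifP => // _; exact: CC.
apply/seteqP; split => z /=.
  move=> pz; rewrite -bigcup_pred; eexists; first exact: pz.
  rewrite -bigcap_seq => i _ /=.
  by rewrite ffunE; case: asboolP.
rewrite -bigcup_pred => -[v pv /=]; rewrite -bigcap_seq => vz.
rewrite (_ : finfun _ = v)//; apply/ffunP => i; rewrite ffunE.
by have := vz i (mem_index_enum i); case: ifP => _; [exact: asboolT|exact: asboolF].
Qed.

(** Separate approximations of the blocks need be neither disjoint nor covering. Repairing this may
    spoil each block on the union of all the error sets, hence the precision [e / k.+1] asked of
    each. *)
Lemma approximate_partition k (A : 'I_k.+1 -> set T) (e : R) :
  borel_partition A -> (forall i, approximable P C (A i)) -> 0 < e ->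
  exists B : 'I_k.+1 -> set T, [/\ borel_partition B, forall i, C (B i) &
    forall i, (P (symdiff (A i) (B i)) <= e%:E)%E].
Proof.
move=> [mA tA UA] aA e0.
have ek0 : 0 < e / k.+1%:R by rewrite divr_gt0.
have /choice[F hF] : forall i, exists B, C B /\ (P (symdiff (A i) B) < (e / k.+1%:R)%:E)%E.
  by move=> i; have [_ /(_ _ ek0)[B CB hB]] := aA i; exists B.
(* A point goes to the first F i containing it, and to block 0 if there is none;
   outside all the symdiff (A j) (F j) this block is the one of the partition A. *)
pose g (v : {ffun 'I_k.+1 -> bool}) : 'I_k.+1 := odflt ord0 [pick i | v i].
pose t z := g [ffun i => `[< F i z >]].
have CB i : C [set z | t z = i].
  rewrite (_ : mkset _ = [set z | g [ffun j => `[< F j z >]] == i]).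
    by apply: (setUC_closed_pattern (fun v => g v == i)) => j; have [] := hF j.
  by apply/seteqP; split => z /eqP.
exists (fun i => [set z | t z = i]); split => // [|i].
  split; first by move=> i; exact: mC.
    by move=> i j _ _ [z [/= <- <-]].
  by apply/seteqP; split => // z _; exists (t z).
have mS j : measurable (symdiff (A j) (F j)).
  by apply: measurable_symdiff => //; apply: mC; have [] := hF j.
apply: (@le_trans _ _ (P (\big[setU/set0]_(j < k.+1) symdiff (A j) (F j)))).
  apply: le_measure; rewrite ?inE.
  - by apply: measurable_symdiff => //; exact: mC.
  - exact: bigsetU_measurable.
  - move=> z hz; apply: contrapT => nz.
    have AF j : A j z <-> F j z.
      split=> h; apply: contrapT => h'; apply: nz; rewrite -bigcup_pred;
        exists j => //; [left|right]; by [].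
    have tz j : A j z -> t z = j.
      move=> Aj; have uniqz j' : A j' z -> j' = j.
        by move=> Aj'; apply: tA => //; exists z.
      rewrite /t /g; case: pickP => [j'|/(_ j)]; rewrite ffunE.
        by move=> /asboolP/AF/uniqz.
      by move=> /asboolP; rewrite -AF.
    have [j _ Aj] : (\bigcup_i A i) z by rewrite UA.
    have tzj := tz _ Aj.
    case: hz => -[] /=; first by move=> /tz ->.
    by rewrite tzj => <-.
apply: (le_trans (probability_bigsetU_le _ mS)).
rewrite (_ : e%:E = \sum_(j < k.+1) (e / k.+1%:R)%:E)%E; last first.
  by rewrite sumEFin sumr_const card_ord -(mulr_natr (e / _)) divfK.
by apply: lee_sum => j _; apply: ltW; have [] := hF j.
Qed.

End partition_approximation.

Lemma fine_measure_symdiff (R : realType) d (T : measurableType d) (P : probability T R)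
    A B e : measurable A -> measurable B -> (P (symdiff A B) <= e%:E)%E ->
  `|fine (P A) - fine (P B)| <= e.
Proof.
have half A' B' : measurable A' -> measurable B' -> (P (symdiff A' B') <= e%:E)%E ->
    fine (P A') - fine (P B') <= e.
  move=> mA mB h; rewrite lerBlDr -lee_fin EFinD !fineK ?fin_num_measure//.
  apply: (@le_trans _ _ (P (symdiff A' B') + P B')%E); last exact: leeD2r.
  apply: measure_leU => //; first exact: measurable_symdiff.
  by move=> x Ax; have [Bx|Bx] := pselect (B' x); [right|left; left].
move=> mA mB h; rewrite ler_norml lerNl opprB !half//.
by rewrite (_ : symdiff B A = symdiff A B)//; exact: setUC.
Qed.

(** * Weak equivalence *)

Section finitely_determined.
Context (R : realType) (G : groupType) (cG : countable [set: G]).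
Context d (X : measurableType d) (mu : probability X R).
Local Notation U := (unit_itv R).
Local Notation W := (power G U).
Local Notation P := (product_probability (lebesgue_power R cG) mu).

Definition finitely_determined : set (set (W * X)) :=
  [set A | measurable A /\ exists J, determined J A].

Lemma determinedS J J' (A : set (W * X)) : {subset J <= J'} -> determined J A -> determined J' A.
Proof. by move=> JJ' JA f f' x ff'; apply: JA => g /JJ'; exact: ff'. Qed.

Lemma finitely_determined_measurable : finitely_determined `<=` measurable.
Proof. by move=> A []. Qed.

Lemma finitely_determined0 : finitely_determined set0.
Proof. by split; [|exists fset0]. Qed.

Lemma finitely_determinedC : setC_closed finitely_determined.
Proof.
move=> A [mA [J JA]]; split; first exact: measurableC.
exists J => f f' x ff' nA A'; apply: nA; apply: JA A' => g gJ.
by rewrite ff'.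
Qed.

Lemma finitely_determinedU : setU_closed finitely_determined.
Proof.
move=> A B [mA [J JA]] [mB [K KB]]; split; first exact: measurableU.
exists (J `|` K)%fset => f f' x ff' [Ax|Bx]; [left|right].
  by apply: JA Ax => g gJ; apply: ff'; rewrite inE gJ.
by apply: KB Bx => g gJ; apply: ff'; rewrite inE gJ orbT.
Qed.

(** The product sigma-algebra is generated by preimages of sets of [X], which depend on no
    coordinate, and of sets of [W], which are themselves generated by sets depending on one
    coordinate. *)
Lemma measurable_approximable (A : set (W * X)) :
  measurable A -> approximable P finitely_determined A.
Proof.
have sA := sigma_algebra_approximable P finitely_determined_measurable
  finitely_determined0 finitely_determinedC finitely_determinedU.
have appr := approximableW P finitely_determined_measurable.
suff : measurable `<=` approximable P finitely_determined by exact.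
apply: smallest_sub => // _ [[B mB <-]|[B mB <-]]; rewrite setTI; last first.
  apply: appr; split; last by exists fset0.
  exact: measurable_preimage.
(* A second generation argument, inside [W]: the sets with approximable preimage form a
   sigma-algebra containing the coordinate sets. *)
pose H := [set B : set W | approximable P finitely_determined (fst @^-1` B)].
suff : measurable `<=` H by move=> /(_ _ mB).
have [s0 sC sU] := sA.
apply: smallest_sub => [|_ [g _ [D mD <-]]].
  split; rewrite /H /=.
  - by rewrite preimage_set0.
  - by move=> D hD; exact: sC hD.
  - by move=> F hF; rewrite preimage_bigcup; exact: sU hF.
rewrite /H /= setTI; apply: appr; split.
  exact: (measurable_preimage (measurableT_comp (measurable_coordinate g) measurable_fst) mD).
by exists [fset g]%fset => f f' x ff'; rewrite /= /coordinate /= ff' ?inE.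
Qed.

End finitely_determined.

Lemma act_image (R : realType) (G : groupType) d (X : measurableType d)
    (mu : probability X R) (a : pmp_action G mu) g A : a g @` A = a g^-1%g @^-1` A.
Proof.
apply/seteqP; split => [_ [x Ax <-]|x Ax] /=; first by rewrite -actM mulVg act1.
by exists (a g^-1%g x) => //; rewrite -actM mulgV act1.
Qed.

(** A partition pulled back along a factor map has exactly the same intersection measures, so the
    error is 0. *)
Lemma weakly_contained_factor (R : realType) (G : groupType)
    d1 (X : measurableType d1) (mu : probability X R) (a : pmp_action G mu)
    d2 (Y : measurableType d2) (nu : probability Y R) (b : pmp_action G nu)
    (f : Y -> X) : measurable_fun setT f ->
  (forall A, measurable A -> nu (f @^-1` A) = mu A) ->
  (forall g y, f (b g y) = a g (f y)) -> weakly_contained a b.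
Proof.
move=> mf nuf fE k A [mA tA UA] F finF e e0.
exists (fun i => f @^-1` A i).
  split; first by move=> i; exact: measurable_preimage.
    by move=> i j _ _ [y [/= Ai Aj]]; apply: tA => //; exists (f y).
  by rewrite -preimage_bigcup UA preimage_setT.
move=> g _ i j.
have mD : measurable (a g @` A i `&` A j).
  by apply: measurableI => //; rewrite act_image; apply: measurable_preimage => //; exact: measurable_act.
rewrite (_ : b g @` _ `&` _ = f @^-1` (a g @` A i `&` A j)).
  by rewrite nuf// subee ?abse0 ?lte_fin// fin_num_measure.
by rewrite !act_image; apply/seteqP; split => y /=; rewrite fE.
Qed.

(** The error [e] is split in two: at most [e / 2] for replacing [A] by a partition [B] into
    finitely determined blocks, and less than [e / 2] for pulling [B] back along an approximate
    factor. *)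
Lemma weakly_contained_bernoulli (R : realType)
  (G : groupType) (cG : countable [set: G])
  d (X : measurableType d) (mu : probability X R) (S : nat -> set X) :
  separating S -> non_atomic mu ->
  forall a : pmp_action G mu, free_action a ->
  weakly_contained (product_action (bernoulli_shift R cG) a) a.
Proof.
move=> sepS na a fa; set b := product_action _ _.
pose P := product_probability (lebesgue_power R cG) mu.
have mS n : measurable (S n) by case: sepS.
(* A space of measure 1 has no partition into zero blocks. *)
case=> [|k] A partA F finF e e0.
  exfalso; have [_ _] := partA; rewrite (_ : \bigcup_i A i = set0); last first.
    by rewrite -subset0 => z [[]].
  move=> h; have := probability_setT P; rewrite -h measure0 => /eqP.
  by rewrite eq_sym onee_eq0.
have [mA _ _] := partA.
have e4 : 0 < e / 4 by rewrite divr_gt0.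
have e2 : 0 < e / 2 by rewrite divr_gt0.
have [B [[mB tB UB] CB AB]] := approximate_partition (@finitely_determined_measurable R G d X)
  (@finitely_determined0 R G d X) (@finitely_determinedC R G d X)
  (@finitely_determinedU R G d X) partA
  (fun i => measurable_approximable cG mu (mA i)) e4.
have /choice[K hK] : forall i, exists J, determined J (B i) by move=> i; have [] := CB i.
have /finite_fsetP[FF FE] := finF.
pose J0 := (\bigcup_(i <- enum 'I_k.+1) K i)%fset.
have JB i : determined J0 (B i).
  apply: determinedS (hK i) => g gK; apply/bigfcupP; exists i => //.
  by rewrite mem_enum.
(* The preimage of [B i] under [g^-1] reads the coordinates [g * h] with [h] in [J0]. *)
pose J := (J0 `|` [fset (g * h)%g | g in FF, h in J0])%fset.
pose I := (FF * 'I_k.+1 * 'I_k.+1)%type.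
pose D g i j := b g^-1%g @^-1` B i `&` B j.
have mD g i j : measurable (D g i j).
  by apply: measurableI => //; apply: measurable_preimage => //; exact: measurable_act.
have JD g i j : g \in FF -> determined J (D g i j).
  move=> gF f f' x ff' [/= Bi Bj]; split => /=.
    apply: (JB i) Bi => h hJ; rewrite /b /= /shift_map invgK; apply: ff'.
    by rewrite inE; apply/orP; right; apply/imfset2P; exists g => //; exists h.
  by apply: (JB j) Bj => h hJ; apply: ff'; rewrite inE hJ.
have [n [u hu]] := @approximate_factor R G cG d X mu a S sepS na fa I
  (fun z => D (val z.1.1) z.1.2 z.2) J (e / 2) (fun z => mD _ _ _)
  (fun z => JD _ _ _ (fsvalP z.1.1)) e2.
pose p := code S n.
have mp m : measurable (p @^-1` [set m]) by exact: measurable_code.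
exists (fun i => factor a p u @^-1` B i).
  split; first by move=> i; apply: measurable_preimage => //; exact: measurable_factor_u.
    by move=> i j _ _ [y [/= Bi Bj]]; apply: tB => //; exists (factor a p u y).
  by rewrite -preimage_bigcup UB preimage_setT.
move=> g Fg i j.
have gF : g \in FF by move: Fg; rewrite FE.
(* Equivariance of [factor] reduces the intersections for [a] to preimages of the sets [D g i j]. *)
have -> : a g @` (factor a p u @^-1` B i) `&` factor a p u @^-1` B j =
    factor a p u @^-1` D g i j.
  rewrite act_image /D; apply/seteqP; split => x /=;
  by rewrite /b /product_action /= /diagonal /= /factor lift_act.
have mgA : measurable (b g @` A i `&` A j).
  by apply: measurableI => //; rewrite act_image; apply: measurable_preimage => //; exact: measurable_act.
have mfD : measurable (factor a p u @^-1` D g i j).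
  by apply: measurable_preimage => //; exact: measurable_factor_u.
(* Each of the two blocks contributes [e / 4]; the translated one does so because [b] preserves the
   measure. *)
have h1 : `|fine (P (b g @` A i `&` A j)) - fine (P (D g i j))| <= e / 2.
  apply: fine_measure_symdiff => //.
  have -> : e / 2 = e / 4 + e / 4 by field.
  rewrite EFinD; apply: le_trans (leeD (AB i) (AB j)).
  rewrite -(act_preserving b g^-1%g (measurable_symdiff (mA i) (mB i))).
  apply: measure_leU; try exact: measurable_symdiff.
    by apply: measurable_preimage; [exact: measurable_act|exact: measurable_symdiff].
  rewrite act_image /D => z [[[/= Ai Aj] nB]|[[/= Bi Bj] nA]].
    have [Bi|Bi] := pselect (B i (b g^-1%g z)); last by left; left.
    by right; left; split => // Bj; apply: nB.
  have [Ai|Ai] := pselect (A i (b g^-1%g z)); last by left; right.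
  by right; right; split => // Aj; apply: nA.
have h2 := hu ([` gF]%fset, i, j); rewrite /= in h2.
rewrite -(fineK (fin_num_measure P _ mgA)) -(fineK (fin_num_measure mu _ mfD)).
rewrite -EFinB abse_EFin lte_fin.
rewrite -(subrKA (fine (P (D g i j)))); apply: le_lt_trans (ler_normD _ _) _.
by rewrite [ltRHS]splitr; apply: ler_ltD => //; rewrite distrC.
Qed.

Theorem corollary1p6 (R : realType)
  (G : groupType) (G_countable : countable [set: G])
  (d : measure_display) (X : measurableType d) (mu : probability X R)
  (X_standard : standard_borel R X) (mu_non_atomic : non_atomic mu)
  (a : pmp_action G mu) (a_free : free_action a) :
  weakly_equivalent (product_action (bernoulli_shift R G_countable) a) a.
Proof.
have [S sepS] := standard_borel_separating X_standard.
split; first exact: (weakly_contained_bernoulli _ sepS).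
apply: (@weakly_contained_factor _ _ _ _ _ _ _ _ _ _ snd) => // A mA.
rewrite (_ : snd @^-1` A = setT `*` A).
  rewrite [LHS]product_measure1E//.
  by rewrite [X in (X * _)%E](probability_setT (lebesgue_power R G_countable)) mul1e.
by apply/seteqP; split => -[f x] //= [].
Qed.
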